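(* If $X\subseteq{}^*\mathbb N$ is an infinite countably determined set, then either there is a unique additive Borel cut $U$ with $X\sim_{\mathrm{CD}}U$, or there is an infinitely large $c\in{}^*\mathbb N\setminus\mathbb N$ such that $c/\mathbb N<_{\mathrm{CD}}X<_{\mathrm{CD}}c\mathbb N$.
   Context: Work in a fixed countably saturated nonstandard universe; ${}^*\mathbb N$ is the set of hyperintegers, $\mathbb N$ the standard ones; internal sets are elements of the internal universe. Borel sets: the $\sigma$-algebra generated by internal sets. A set $X$ is countably determined (CD) if $X=\bigcup_{f\in F}\bigcap_{m\in\mathbb N}X_{f\restriction m}$ for some $F\subseteq 2^{\mathbb N}$ and internal sets $X_s$ indexed by finite binary sequences $s$, with $X_t\subseteq X_s$ whenever $s\subset t$. A map is CD if its graph is CD. $X\le_{\mathrm{CD}}Y$ means there is a CD injection $X\to Y$; $X\sim_{\mathrm{CD}}Y$ means both $X\le_{\mathrm{CD}}Y$ and $Y\le_{\mathrm{CD}}X$; $X<_{\mathrm{CD}}Y$ means $X\le_{\mathrm{CD}}Y$ but not $Y\le_{\mathrm{CD}}X$. A cut is an initial segment of ${}^*\mathbb N$; it is additive if $x+y\in U$ whenever $x,y\in U$. For $c\in{}^*\mathbb N$: $c\mathbb N=\bigcup_{n\in\mathbb N}[0,cn]$ and $c/\mathbb N=\bigcap_{n\in\mathbb N,\,n\ge1}[0,c/n]$ (intervals in ${}^*\mathbb N$). *)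

(* Defs.v *)
From mathcomp Require Import all_boot.
From mathcomp Require Import boolp classical_sets functions cardinality.
From mathcomp Require Import measurable_structure.

Set Implicit Arguments.
Unset Strict Implicit.
Unset Printing Implicit Defensive.

Local Open Scope classical_set_scope.

(* Types of the entities in a superstructure: atoms, sets of entities of a given
   type, ordered pairs.  [elt B t] is the set of all entities of type [t] in the
   full superstructure over the base set [B]. *)
Inductive ty := base | pow of ty | prd of ty & ty.

Fixpoint elt (B : Type) (t : ty) : Type :=
  match t with
  | base => B
  | pow t => set (elt B t)
  | prd t u => (elt B t * elt B u)%type
  end.

(* Bounded formulas in the language of superstructures, with variables as typed
   de Bruijn indices in a context [G].  In [fall y p] and [fex y p] the bound
   variable ranges over the elements of the set denoted by [y] and becomes
   variable number 0 in [p]. *)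
Inductive var : seq ty -> ty -> Type :=
| vz G t : var (t :: G) t
| vs G t u : var G t -> var (u :: G) t.

Inductive formula : seq ty -> Type :=
| feq G t of var G t & var G t : formula G
| fmem G t of var G t & var G (pow t) : formula G
| fpair G t u of var G t & var G u & var G (prd t u) : formula G
| fnot G of formula G : formula G
| fand G of formula G & formula G : formula G
| for_ G of formula G & formula G : formula G
| fimp G of formula G & formula G : formula G
| fall G t of var G (pow t) & formula (t :: G) : formula G
| fex G t of var G (pow t) & formula (t :: G) : formula G.

Fixpoint env (B : Type) (G : seq ty) : Type :=
  match G with
  | [::] => unit
  | t :: G => (elt B t * env B G)%type
  end.

Fixpoint lookup (B : Type) G t (x : var G t) : env B G -> elt B t :=
  match x with
  | vz _ _ => fun e => e.1
  | vs _ _ _ x => fun e => lookup x e.2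
  end.

Fixpoint map_env (B C : Type) (f : forall t, elt B t -> elt C t) (G : seq ty) :
    env B G -> env C G :=
  match G with
  | [::] => fun e => e
  | t :: G => fun e => (f t e.1, map_env f e.2)
  end.

Fixpoint sat (B : Type) G (p : formula G) : env B G -> Prop :=
  match p with
  | feq _ _ x y => fun e => lookup x e = lookup y e
  | fmem _ _ x y => fun e => lookup y e (lookup x e)
  | fpair _ _ _ x y z => fun e => lookup z e = (lookup x e, lookup y e)
  | fnot _ p => fun e => ~ sat p e
  | fand _ p q => fun e => sat p e /\ sat q e
  | for_ _ p q => fun e => sat p e \/ sat q e
  | fimp _ p q => fun e => sat p e -> sat q e
  | fall _ _ y p => fun e => forall a, lookup y e a -> sat p (a, e)
  | fex _ _ y p => fun e => exists a, lookup y e a /\ sat p (a, e)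
  end.

Definition internal_for (B : Type) (star : forall t, elt nat t -> elt B t)
    (t : ty) (x : elt B t) : Prop :=
  exists S : elt nat (pow t), star (pow t) S x.

(* A countably saturated nonstandard universe: a star-map from the
   superstructure over the standard natural numbers to the superstructure over
   some base set *N, with *(N) = *N, which satisfies transfer for all bounded
   formulas with standard parameters and countable saturation. *)
Record nonstandard_universe := NonstandardUniverse {
  hbase : Type;
  star : forall t, elt nat t -> elt hbase t;
  star_base : @star (pow base) setT = setT;
  transfer : forall G (p : formula G) (e : env nat G),
    sat p e <-> sat p (map_env star e);
  saturation : forall t (A : nat -> set (elt hbase t)),
    (forall n, internal_for (t := pow t) star (A n)) ->
    (forall n, \bigcap_(i in `I_n) A i !=set0) ->
    \bigcap_i A i !=set0 }.

Arguments star : clear implicits.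

Notation hnat W := (elt (hbase W) base).

Section Nonstandard.
Variable W : nonstandard_universe.

Definition internal (t : ty) (x : elt (hbase W) t) : Prop :=
  internal_for (star W) x.

Definition std (n : nat) : hnat W := star W base n.

(* Extension to *N of a binary operation of N: the operation whose graph is the
   star-image of the graph. *)
Definition op_graph (f : nat -> nat -> nat) : elt nat (prd (prd base base) base) -> Prop :=
  [set p | f p.1.1 p.1.2 = p.2].

Lemma hop_total f (x y : hnat W) :
  exists z : hnat W, star W (pow (prd (prd base base) base)) (op_graph f) (x, y, z).
Proof.
pose G := [:: pow base; pow (prd base base); pow (prd (prd base base) base)].
pose e : env nat G := (setT, (setT, (op_graph f, tt))).
(* for all x, y in N there are z in N, q in N * N and r in the graph of f such
   that q = (x, y) and r = (q, z) *)
pose p : formula G := fall (vz _ _) (fall (vs _ (vz _ _)) (fex (vs _ (vs _ (vz _ _)))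
  (fex (vs _ (vs _ (vs _ (vs _ (vz _ _)))))
  (fex (vs _ (vs _ (vs _ (vs _ (vs _ (vs _ (vz _ _)))))))
   (fand (fpair (vs _ (vs _ (vs _ (vs _ (vz _ _))))) (vs _ (vs _ (vs _ (vz _ _))))
                (vs _ (vz _ _)))
         (fpair (vs _ (vz _ _)) (vs _ (vs _ (vz _ _))) (vz _ _))))))).
have : sat p e.
  move=> a _ b _; exists (f a b); split=> //; exists (a, b); split=> //.
  by exists (a, b, f a b).
move/(transfer W p e) => /=; rewrite star_base.
move=> /(_ x I y I) [z [_ [q [_ [r [rf [qE rE]]]]]]].
by exists z; rewrite -qE -rE.
Qed.

Definition hop f (x y : hnat W) : hnat W := sval (cid (hop_total f x y)).

Definition hle (x y : hnat W) : Prop :=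
  star W (pow (prd base base)) [set p | (p.1 <= p.2)%N] (x, y).

Definition hinterval (c : hnat W) : set (hnat W) := [set x | hle x c].

(* Countably determined sets; the first [m] values of [f] form [mkseq f m]. *)
Definition countably_determined (t : ty) (X : set (elt (hbase W) t)) : Prop :=
  exists (F : set (nat -> bool)) (A : seq bool -> set (elt (hbase W) t)),
    [/\ forall s, internal (t := pow t) (A s),
        forall s s', prefix s s' -> A s' `<=` A s &
        X = \bigcup_(f in F) \bigcap_m A (mkseq f m)].

Definition le_CD (t u : ty) (X : set (elt (hbase W) t)) (Y : set (elt (hbase W) u)) :
    Prop :=
  exists f : elt (hbase W) t -> elt (hbase W) u,
    [/\ set_fun X Y f, set_inj X f &
        countably_determined (t := prd t u) [set p | X p.1 /\ f p.1 = p.2]].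

Definition equiv_CD t u (X : set (elt (hbase W) t)) (Y : set (elt (hbase W) u)) : Prop :=
  le_CD X Y /\ le_CD Y X.

Definition lt_CD t u (X : set (elt (hbase W) t)) (Y : set (elt (hbase W) u)) : Prop :=
  le_CD X Y /\ ~ le_CD Y X.

Definition borel (t : ty) (X : set (elt (hbase W) t)) : Prop :=
  <<s [set A : set (elt (hbase W) t) | internal (t := pow t) A] >> X.

Definition cut (U : set (hnat W)) : Prop :=
  forall x y, U y -> hle x y -> U x.

Definition additive_cut (U : set (hnat W)) : Prop :=
  cut U /\ forall x y, U x -> U y -> U (hop addn x y).

Definition cN (c : hnat W) : set (hnat W) :=
  \bigcup_(n : nat) hinterval (hop muln c (std n)).

(* For x in *N, x <= c / n iff x is at most the integer part of c / n. *)
Definition c_over_N (c : hnat W) : set (hnat W) :=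
  \bigcap_(n in [set n : nat | (1 <= n)%N]) hinterval (hop divn c (std n)).

End Nonstandard.

(* Main.v *)
From HB Require Import structures.
Require Import Defs.
From mathcomp Require Import all_boot zify.
From mathcomp Require Import boolp classical_sets functions cardinality.
From mathcomp Require Import measurable_structure.

(* Write X as the union over f in F of the nested intersections of internal sets
   A(f|m), and let C be the cut of all c such that, for some f in F, every A(f|m)
   has more than c elements.  If c is in C but 2c is not, then c/N <= [0, c] <= X
   and X is covered by countably many internal sets of size at most 2c, so that
   c/N <= X <= cN.  If C is additive and X is covered by countably many internal
   sets whose sizes are in C, then C has countable cofinality and X ~ C is obtained
   by gluing countably many internal injections.  Otherwise C is determined by a
   single f in F, C <= X by saturation, and either C = e/N for some e, so that
   e/N <= X <= eN, or C is the intersection of intervals [0, e_n) with e_n / e_(n+1)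
   infinite; in the latter case X is contained in internal sets of size at most e_n
   for all n, and one internal injection obtained by saturation maps X into C.
   When c/N <= X <= cN with c infinite, either X is equivalent to one of the two
   additive cuts, or both inequalities are strict.
   Uniqueness: a countably determined injection is covered by countably many
   internal partial injections; if U is an additive cut and c is not in U, these
   cannot map [0, c] into U, since U is Loeb-null relative to c. *)

Set Implicit Arguments.
Unset Strict Implicit.
Unset Printing Implicit Defensive.

Local Open Scope classical_set_scope.

(** * Transfer for predicates and functions *)

Local Notation v0 := (vz _ _).
Local Notation v1 := (vs _ v0).
Local Notation v2 := (vs _ v1).
Local Notation v3 := (vs _ v2).
Local Notation v4 := (vs _ v3).
Local Notation v5 := (vs _ v4).
Local Notation v6 := (vs _ v5).
Local Notation v7 := (vs _ v6).
Local Notation v8 := (vs _ v7).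
Local Notation v9 := (vs _ v8).

Definition fiff G (p q : formula G) := fand (fimp p q) (fimp q p).

Section Transfer.
Variable W : nonstandard_universe.
Notation B := (hbase W).
Implicit Types t u v : ty.

(* [Q] is the nonstandard extension of the standard predicate [P]; only its values
   on internal points matter. *)
Record Tr t (P : set (elt nat t)) (Q : set (elt B t)) : Prop := MkTr {
  TrE :> forall x, internal x -> star W (pow t) P x <-> Q x }.

Definition graph t u (f : elt nat t -> elt nat u) : elt nat (pow (prd t u)) :=
  [set p | f p.1 = p.2].

Record Ext t u (f : elt nat t -> elt nat u) (g : elt B t -> elt B u) : Prop := MkExt {
  ExtE :> forall x, internal x -> star W (pow (prd t u)) (graph f) (x, g x) }.

Lemma star_sub t (P Q : set (elt nat t)) :
  P `<=` Q -> star W (pow t) P `<=` star W (pow t) Q.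
Proof.
move=> PQ.
by have /= := (transfer W (G := [:: pow t; pow t]) (fall v0 (fmem v0 v2)) (P, (Q, tt))).1 PQ.
Qed.

Lemma internalE t (x : elt B t) : internal x <-> star W (pow t) setT x.
Proof. by split=> [[S]|h]; [apply: star_sub | exists setT]. Qed.

Lemma internal_base (x : hnat W) : internal x.
Proof. by apply/internalE; rewrite star_base. Qed.

Lemma internal_pair t u (x : elt B t) (y : elt B u) :
  internal (t := prd t u) (x, y) <-> internal x /\ internal y.
Proof.
pose G := [:: pow t; pow u; pow (prd t u)].
have := (transfer W (G := G) (fand (fall v0 (fall v2 (fex v4 (fpair v2 v1 v0))))
   (fall v2 (fex v1 (fex v3 (fpair v1 v0 v2))))) (setT, (setT, (setT, tt)))).1.
case=> /=.
  split; first by move=> a _ b _; exists (a, b).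
  by move=> [a b] _; exists a; split => //; exists b.
move=> h1 h2; split.
  move/internalE/h2 => [a [aT [b [bT [-> ->]]]]].
  by split; apply/internalE.
by case=> /internalE xT /internalE yT; apply/internalE; have [q [? <-]] := h1 _ xT _ yT.
Qed.

Lemma internal_mem t (A : set (elt B t)) x :
  internal (t := pow t) A -> A x -> internal x.
Proof.
move=> /internalE AT Ax; apply/internalE.
have /= := (transfer W (G := [:: pow (pow t); pow t]) (fall v0 (fall v0 (fmem v0 v3))) (setT, (setT, tt))).1.
by apply; [move=> //| exact: AT |].
Qed.

Lemma Ext_internal t u f g (x : elt B t) : @Ext t u f g -> internal x -> internal (g x).
Proof.
move=> fg xi; have h := fg x xi.
by have /internal_pair [] : internal (t := prd t u) (x, g x) by exists (graph f).
Qed.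

Lemma Tr_ext t (P P' : set (elt nat t)) Q : P = P' -> Tr P Q -> Tr P' Q.
Proof. by move=> ->. Qed.

Lemma transfer_all t P Q : @Tr t P Q -> (forall x, P x) -> forall x, internal x -> Q x.
Proof.
move=> PQ Px x xi; apply/(PQ x xi).
by apply: (@star_sub t setT) => [y _|]; [exact: Px|apply/internalE].
Qed.

Lemma Tr_not t P Q : @Tr t P Q -> Tr (fun x => ~ P x) (fun x => ~ Q x).
Proof.
move=> PQ; apply: MkTr => x xi; rewrite -(PQ x xi).
have /= := (transfer W (G := [:: pow t; pow t; pow t])
  (fall v0 (fiff (fmem v0 v2) (fnot (fmem v0 v3)))) (setT, ((fun x => ~ P x), (P, tt)))).1.
by move=> h; apply: h => //; apply/internalE.
Qed.

Lemma Tr_and t P Q P' Q' : @Tr t P Q -> @Tr t P' Q' ->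
  Tr (fun x => P x /\ P' x) (fun x => Q x /\ Q' x).
Proof.
move=> PQ PQ'; apply: MkTr => x xi; rewrite -(PQ x xi) -(PQ' x xi).
have /= := (transfer W (G := [:: pow t; pow t; pow t; pow t])
  (fall v0 (fiff (fmem v0 v2) (fand (fmem v0 v3) (fmem v0 v4))))
   (setT, ((fun x => P x /\ P' x), (P, (P', tt))))).1.
by move=> h; apply: h => //; apply/internalE.
Qed.

Lemma Tr_or t P Q P' Q' : @Tr t P Q -> @Tr t P' Q' ->
  Tr (fun x => P x \/ P' x) (fun x => Q x \/ Q' x).
Proof.
move=> PQ PQ'; apply: MkTr => x xi; rewrite -(PQ x xi) -(PQ' x xi).
have /= := (transfer W (G := [:: pow t; pow t; pow t; pow t])
  (fall v0 (fiff (fmem v0 v2) (for_ (fmem v0 v3) (fmem v0 v4))))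
   (setT, ((fun x => P x \/ P' x), (P, (P', tt))))).1.
by move=> h; apply: h => //; apply/internalE.
Qed.

Lemma Tr_imp t P Q P' Q' : @Tr t P Q -> @Tr t P' Q' ->
  Tr (fun x => P x -> P' x) (fun x => Q x -> Q' x).
Proof.
move=> PQ PQ'; apply: MkTr => x xi; rewrite -(PQ x xi) -(PQ' x xi).
have /= := (transfer W (G := [:: pow t; pow t; pow t; pow t])
  (fall v0 (fiff (fmem v0 v2) (fimp (fmem v0 v3) (fmem v0 v4))))
   (setT, ((fun x => P x -> P' x), (P, (P', tt))))).1.
by move=> h; apply: h => //; apply/internalE.
Qed.

Lemma Tr_ex t u (P : elt nat t -> elt nat u -> Prop) Q :
  @Tr (prd t u) (fun p => P p.1 p.2) (fun p => Q p.1 p.2) ->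
  Tr (fun x => exists y, P x y) (fun x => exists y, internal y /\ Q x y).
Proof.
move=> PQ; apply: MkTr => x xi.
have /= := (transfer W (G := [:: pow t; pow t; pow u; pow (prd t u)])
  (fall v0 (fiff (fmem v0 v2) (fex v3 (fex v5 (fpair v2 v1 v0)))))
   (setT, ((fun x => exists y, P x y), (setT, ((fun p => P p.1 p.2), tt))))).1.
move=> h; have [||h1 h2] := h _ x.
- move=> a _ /=; split.
    by move=> [y Py]; exists y; split=> //; exists (a, y).
  by move=> [y [_ [q [Pq qE]]]]; exists y; move: Pq; rewrite qE.
- exact/internalE.
split.
  move/h1 => [y [yT [q [Pq qE]]]]; exists y; split; first exact/internalE.
  have qi : internal (t := prd t u) (x, y) by apply/internal_pair; split=> //; apply/internalE.
  by apply/(PQ (x, y) qi); rewrite -qE.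
case=> y [yi Qxy]; apply: h2; exists y; split; first exact/internalE.
have qi : internal (t := prd t u) (x, y) by apply/internal_pair.
by exists (x, y); split => //; apply/(PQ _ qi).
Qed.

Lemma Tr_all t u (P : elt nat t -> elt nat u -> Prop) Q :
  @Tr (prd t u) (fun p => P p.1 p.2) (fun p => Q p.1 p.2) ->
  Tr (fun x => forall y, P x y) (fun x => forall y, internal y -> Q x y).
Proof.
move=> PQ.
have -> : (fun x => forall y, P x y) = (fun x => ~ exists y, ~ P x y).
  by apply: funext => x; apply: propext; rewrite -forallNP; split=> h y; move: (h y); rewrite notK.
apply: MkTr => x xi; rewrite (TrE (Tr_not (Tr_ex (Q := fun x y => ~ Q x y) (Tr_not PQ))) xi).
rewrite -forallNP; split=> h y.
  by move=> yi; apply: contrapT => nq; apply: (h y).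
by case=> yi; apply; apply: h.
Qed.

Lemma Tr_ex_base t (P : elt nat t -> nat -> Prop) (Q : elt B t -> hnat W -> Prop) :
  @Tr (prd t base) (fun p => P p.1 p.2) (fun p => Q p.1 p.2) ->
  Tr (fun x => exists y, P x y) (fun x => exists y, Q x y).
Proof.
move=> PQ; apply: MkTr => x xi; rewrite (TrE (Tr_ex (u := base) PQ) xi).
by split=> [[y []]|[y]]; exists y => //; split=> //; apply: internal_base.
Qed.

Lemma Tr_all_base t (P : elt nat t -> nat -> Prop) (Q : elt B t -> hnat W -> Prop) :
  @Tr (prd t base) (fun p => P p.1 p.2) (fun p => Q p.1 p.2) ->
  Tr (fun x => forall y, P x y) (fun x => forall y, Q x y).
Proof.
move=> PQ; apply: MkTr => x xi; rewrite (TrE (Tr_all (u := base) PQ) xi).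
by split=> h y *; apply: h => //; apply: internal_base.
Qed.

Lemma Tr_comp t u P Q f g : @Ext t u f g -> @Tr u P Q ->
  Tr (fun x => P (f x)) (fun x => Q (g x)).
Proof.
move=> fg PQ; apply: MkTr => x xi.
have gi := Ext_internal fg xi.
rewrite -(PQ _ gi).
have /= := (transfer W (G := [:: pow t; pow u; pow (prd t u); pow t; pow u])
  (fall v0 (fall v2 (fall v4 (fimp (fpair v2 v1 v0) (fiff (fmem v2 v6) (fmem v1 v7))))))
   (setT, (setT, (graph f, ((fun x => P (f x)), (P, tt)))))).1.
move=> h; have := h _ x _ (g x) _ (x, g x) (fg _ xi) erefl; apply.
- by move=> a _ b _ q qf /= qE; move: qf; rewrite qE /graph /= => ->.
- exact/internalE.
- exact/internalE.
Qed.

Lemma Ext_id t : @Ext t t id id.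
Proof.
apply: MkExt => x xi.
have /= := (transfer W (G := [:: pow t; pow (prd t t)])
  (fall v0 (fex v2 (fpair v1 v1 v0))) (setT, (@graph t t id, tt))).1.
move=> h; have [||q [? <-]] := h _ x; last by [].
  by move=> a _; exists (a, a).
exact/internalE.
Qed.

Lemma Ext_comp t u v f g f' g' : @Ext t u f g -> @Ext u v f' g' ->
  Ext (fun x => f' (f x)) (fun x => g' (g x)).
Proof.
move=> fg fg'; apply: MkExt => x xi.
have gi := Ext_internal fg xi.
have gi' := Ext_internal fg' gi.
have /= := (transfer W (G := [:: pow t; pow u; pow v; pow (prd t u); pow (prd u v); pow (prd t v)])
  (fall v0 (fall v2 (fall v4 (fall v6 (fall v8 (fimp (fand (fpair v4 v3 v1) (fpair v3 v2 v0))
     (fex (vs _ (vs _ v8)) (fpair v5 v3 v0))))))))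
   (setT, (setT, (setT, (graph f, (graph f', (graph (fun x => f' (f x)), tt))))))).1.
move=> h.
have [||||q [gq <- //]] := h _ x _ (g x) _ (g' (g x)) _ (x, g x) (fg _ xi)
  (g x, g' (g x)) (fg' _ gi) (conj erefl erefl) => //.
- move=> a _ b _ c _ q qf r rf [qE rE]; exists (a, c).
  by move: qf rf; rewrite qE rE /graph /= => -> ->.
- exact/internalE.
- exact/internalE.
- exact/internalE.
Qed.

Lemma Ext_fst0 t u : @Ext (prd t u) t fst fst.
Proof.
apply: MkExt => -[x y] pi; have [xi yi] := (internal_pair x y).1 pi.
have /= := (transfer W (G := [:: pow t; pow u; pow (prd t u); pow (prd (prd t u) t)])
  (fall v0 (fall v2 (fall v4 (fimp (fpair v2 v1 v0) (fex v6 (fpair v1 v3 v0))))))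
   (setT, (setT, (setT, (@graph (prd t u) t fst, tt))))).1.
move=> h; have [||||q [gq <- //]] := h _ x _ y _ (x, y) _ erefl => //.
- by move=> a _ b _ q _ ->; exists (a, b, a).
- exact/internalE.
- exact/internalE.
- exact/internalE.
Qed.

Lemma Ext_snd0 t u : @Ext (prd t u) u snd snd.
Proof.
apply: MkExt => -[x y] pi; have [xi yi] := (internal_pair x y).1 pi.
have /= := (transfer W (G := [:: pow t; pow u; pow (prd t u); pow (prd (prd t u) u)])
  (fall v0 (fall v2 (fall v4 (fimp (fpair v2 v1 v0) (fex v6 (fpair v1 v2 v0))))))
   (setT, (setT, (setT, (@graph (prd t u) u snd, tt))))).1.
move=> h; have [||||q [gq <- //]] := h _ x _ y _ (x, y) _ erefl => //.
- by move=> a _ b _ q _ ->; exists (a, b, b).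
- exact/internalE.
- exact/internalE.
- exact/internalE.
Qed.

Lemma Ext_fst t u v (f : elt nat v -> elt nat (prd t u)) g :
  Ext f g -> @Ext v t (fun x => (f x).1) (fun x => (g x).1).
Proof. by move=> fg; exact (@Ext_comp v (prd t u) t f g fst fst fg (@Ext_fst0 t u)). Qed.

Lemma Ext_snd t u v (f : elt nat v -> elt nat (prd t u)) g :
  Ext f g -> @Ext v u (fun x => (f x).2) (fun x => (g x).2).
Proof. by move=> fg; exact (@Ext_comp v (prd t u) u f g snd snd fg (@Ext_snd0 t u)). Qed.

Lemma Tr_eq t u f g f' g' : @Ext t u f g -> @Ext t u f' g' ->
  Tr (fun x => f x = f' x) (fun x => g x = g' x).
Proof.
move=> fg fg'; apply: MkTr => x xi.
have gi := Ext_internal fg xi.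
have gi' := Ext_internal fg' xi.
have /= := (transfer W (G := [:: pow t; pow u; pow (prd t u); pow (prd t u); pow t])
  (fall v0 (fall v2 (fall v3 (fall v5 (fall v7 (fimp (fand (fpair v4 v3 v1) (fpair v4 v2 v0))
     (fiff (fmem v4 v9) (feq v3 v2))))))))
   (setT, (setT, (graph f, (graph f', ((fun x => f x = f' x), tt)))))).1.
move=> h; have := h _ x _ (g x) _ (g' x) _ (x, g x) (fg _ xi) (x, g' x) (fg' _ xi) (conj erefl erefl).
apply.
- move=> a _ b _ c _ q qf r rf [qE rE].
  by move: qf rf; rewrite qE rE /graph /= => -> ->.
- exact/internalE.
- exact/internalE.
- exact/internalE.
Qed.

Lemma Tr_mem t u f g f' g' : @Ext t u f g -> @Ext t (pow u) f' g' ->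
  Tr (fun x => f' x (f x)) (fun x => g' x (g x)).
Proof.
move=> fg fg'; apply: MkTr => x xi.
have gi := Ext_internal fg xi.
have gi' := Ext_internal fg' xi.
have /= := (transfer W (G := [:: pow t; pow u; pow (pow u); pow (prd t u); pow (prd t (pow u)); pow t])
  (fall v0 (fall v2 (fall v4 (fall v6 (fall v8 (fimp (fand (fpair v4 v3 v1) (fpair v4 v2 v0))
     (fiff (fmem v4 (vs _ v9)) (fmem v3 v2))))))))
   (setT, (setT, (setT, (graph f, (graph f', ((fun x => f' x (f x)), tt))))))).1.
move=> h; have := h _ x _ (g x) _ (g' x) _ (x, g x) (fg _ xi) (x, g' x) (fg' _ xi) (conj erefl erefl).
apply.
- move=> a _ b _ c _ q qf r rf [qE rE].
  by move: qf rf; rewrite qE rE /graph /= => -> ->.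
- exact/internalE.
- exact/internalE.
- exact/internalE.
Qed.

Lemma Ext_of_Tr t u f g (R : elt B (prd t u) -> Prop) :
  (forall x, internal x -> internal (g x) /\ R (x, g x)) -> @Tr (prd t u) (graph f) R ->
  @Ext t u f g.
Proof.
move=> Rg TR; apply: MkExt => x xi; have [gi Rx] := Rg x xi.
by rewrite (TR (x, g x)) //; apply/internal_pair.
Qed.

Lemma Ext_pair t u v f g f' g' : @Ext t u f g -> @Ext t v f' g' ->
  @Ext t (prd u v) (fun x => (f x, f' x)) (fun x => (g x, g' x)).
Proof.
move=> fg fg'.
refine (@Ext_of_Tr t (prd u v) _ _ (fun p => g p.1 = p.2.1 /\ g' p.1 = p.2.2) _ _) => [x xi|].
  split=> //; apply/internal_pair; split; [exact: (Ext_internal fg xi)|exact: (Ext_internal fg' xi)].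
have -> : @graph t (prd u v) (fun x => (f x, f' x)) =
  ((fun p => f p.1 = p.2.1 /\ f' p.1 = p.2.2) : set (elt nat (prd t (prd u v)))).
  by apply: funext => -[x [y z]]; apply: propext; rewrite /graph /=; split=> [[-> ->]|[-> ->]].
have e := @Ext_id (prd t (prd u v)).
apply: Tr_and; apply: Tr_eq.
- exact (@Ext_comp (prd t (prd u v)) t u fst fst f g (@Ext_fst0 _ _) fg).
- exact (Ext_fst (Ext_snd e)).
- exact (@Ext_comp (prd t (prd u v)) t v fst fst f' g' (@Ext_fst0 _ _) fg').
- exact (Ext_snd (Ext_snd e)).
Qed.

Lemma Ext_set t u P Q : @Tr (prd t u) (fun p => P p.1 p.2) (fun p => Q p.1 p.2) ->
  @Ext t (pow u) (fun x => [set y | P x y]) (fun x => [set y | internal y /\ Q x y]).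
Proof.
move=> PQ.
have e3 := @Ext_id (prd (prd t (pow u)) u).
have T : @Tr (prd t (pow u)) (@graph t (pow u) (fun x => [set y | P x y]))
   (fun p => forall y, internal y -> (p.2 y -> Q p.1 y) /\ (Q p.1 y -> p.2 y)).
  have -> : @graph t (pow u) (fun x => [set y | P x y]) =
    ((fun p => forall y, (p.2 y -> P p.1 y) /\ (P p.1 y -> p.2 y)) : set (elt nat (prd t (pow u)))).
    apply: funext => -[x A]; apply: propext; rewrite /graph /=; split=> [<- //|h].
    by apply: funext => y; apply: propext; split => /h.
  refine (@Tr_all (prd t (pow u)) u _ (fun p y => (p.2 y -> Q p.1 y) /\ (Q p.1 y -> p.2 y)) _).
  apply: Tr_and; apply: Tr_imp.
  - exact (Tr_mem (Ext_snd e3) (Ext_snd (Ext_fst e3))).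
  - exact (@Tr_comp (prd (prd t (pow u)) u) (prd t u) _ _ (fun p => (p.1.1, p.2)) (fun p => (p.1.1, p.2))
       (Ext_pair (Ext_fst (Ext_fst e3)) (Ext_snd e3)) PQ).
  - exact (@Tr_comp (prd (prd t (pow u)) u) (prd t u) _ _ (fun p => (p.1.1, p.2)) (fun p => (p.1.1, p.2))
       (Ext_pair (Ext_fst (Ext_fst e3)) (Ext_snd e3)) PQ).
  - exact (Tr_mem (Ext_snd e3) (Ext_snd (Ext_fst e3))).
apply: (Ext_of_Tr _ T) => x xi.
have EA : forall x : elt B t, internal x -> exists A : elt B (pow u), internal A /\
   forall y, internal y -> (A y -> Q x y) /\ (Q x y -> A y).
  have TE := @Tr_ex t (pow u) (fun x A => A = [set y | P x y])
    (fun x A => forall y, internal y -> (A y -> Q x y) /\ (Q x y -> A y)).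
  apply: transfer_all (TE _) _; last by move=> y; exists [set z | P y z].
  by apply: Tr_ext T; apply: funext => -[y A]; rewrite /graph /=; apply: propext; split.
have [A [Ai AE]] := EA x xi.
have -> : [set y | internal y /\ Q x y] = A.
  apply/seteqP; split=> y /=; first by case=> yi /(AE _ yi).2.
  by move=> Ay; have yi := internal_mem Ai Ay; split=> //; apply: (AE y yi).1.
by split.
Qed.

End Transfer.

(** * Injections between sets of natural numbers *)

Section Relations.
Variable T : Type.
Implicit Types (g : set (T * T)) (A D : set T).

Definition pinj g :=
  (forall x y y', g (x, y) -> g (x, y') -> y = y') /\
  (forall x x' y, g (x, y) -> g (x', y) -> x = x').

Definition injr g A D :=
  [/\ pinj g, forall x, A x -> exists y, g (x, y) &
      forall x y, g (x, y) -> A x /\ D y].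

Lemma injr_card g A D : injr g A D -> (A #<= D)%card.
Proof.
case=> -[gf gi] gA gD.
have /choice [f fP] : forall x, exists y, A x -> g (x, y).
  by move=> x; have [/gA [y gxy]|nAx] := pselect (A x); [exists y | exists x].
have fi : {in A &, injective f}.
  move=> x x' /set_mem Ax /set_mem Ax' e; apply: (gi _ _ (f x)); first exact: fP.
  by rewrite e; exact: fP.
have := inj_card_eq fi; rewrite card_eq_sym => e.
rewrite (card_le_eql e); apply: subset_card_le => _ [x Ax <-].
by have [] := gD _ _ (fP x Ax).
Qed.

Lemma injr_fun (f : T -> T) A D : set_fun A D f -> set_inj A f ->
  injr [set p | A p.1 /\ f p.1 = p.2] A D.
Proof.
move=> fAD fi; split=> /=.
- split=> [x y y' /= [_ <-] [_ <-] //|x x' y /= [Ax <-] [Ax' e]].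
  by apply: fi; rewrite ?inE //; apply/esym.
- by move=> x Ax; exists (f x).
- by move=> x y /= [Ax <-]; split=> //; apply: fAD.
Qed.

End Relations.

Section StandardFacts.
Implicit Types (A D P Q : set nat) (g h : set (nat * nat)).

Lemma card_injr A D : (A #<= D)%card -> exists g, injr g A D.
Proof.
move=> /pcard_leP [f]; exists [set p | A p.1 /\ f p.1 = p.2].
apply: injr_fun; [exact: funS|exact: inj].
Qed.

Definition le_nat (x y : nat) : Prop := (x <= y)%N.
Definition iic T (le : T -> T -> Prop) (c : T) : set T := [set x | le x c].
Definition iio T (le : T -> T -> Prop) (c : T) : set T := [set x | ~ le c x].

Lemma iic_nat c : iic le_nat c = `I_c.+1.
Proof. by apply/seteqP; split=> x; rewrite /iic /le_nat /= ltnS. Qed.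

Lemma iio_nat c : iio le_nat c = `I_c.
Proof. by apply/seteqP; split=> x; rewrite /iio /le_nat /= ltnNge => /negP. Qed.

Lemma card_le_or_II A c : (`I_c.+1 #<= A)%card \/ (A #<= `I_c)%card.
Proof.
have [[n An]|Ainf] := pselect (finite_set A); last first.
  by left; apply: card_le_trans ((infiniteP _).1 Ainf); apply: subset_card_le.
have [cn|nc] := leqP c.+1 n.
  left; rewrite card_eq_sym in An; rewrite -(card_le_eqr An) card_le_II //.
by right; rewrite (card_le_eql An) card_le_II.
Qed.


Definition bign A c := exists g, injr g (iic le_nat c) A.
Definition smalln A c := exists g, injr g A (iio le_nat c).

Lemma bignP A c : bign A c <-> (`I_c.+1 #<= A)%card.
Proof.
by rewrite /bign iic_nat; split=> [[g /injr_card]|/card_injr].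
Qed.

Lemma smallnP A c : smalln A c <-> (A #<= `I_c)%card.
Proof.
by rewrite /smalln iio_nat; split=> [[g /injr_card]|/card_injr].
Qed.

Lemma big_or_smalln A c : bign A c \/ smalln A c.
Proof. by case: (card_le_or_II A c) => h; [left; apply/bignP|right; apply/smallnP]. Qed.

Lemma iic_iion a c g : injr g (iic le_nat a) (iio le_nat c) -> ~ le_nat c a.
Proof.
move=> /injr_card; rewrite iic_nat iio_nat card_le_II /le_nat => ac.
by apply/negP; rewrite -ltnNge.
Qed.

Lemma smallnU A D a b : smalln A a -> smalln D b -> smalln (A `|` D) (a + b).
Proof.
move=> /smallnP/pcard_leP [f] /smallnP/pcard_leP [f'].
rewrite /smalln iio_nat.
exists [set p | (A `|` D) p.1 /\ (fun x => if pselect (A x) then f x else a + f' x) p.1 = p.2].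
apply: (injr_fun (f := fun x => if pselect (A x) then f x else a + f' x)).
  move=> x; case: pselect => /= [Ax _|nAx [//|Dx]].
    by have := @funS _ _ _ _ f x Ax => /= /leq_trans; apply; apply: leq_addr.
  by have := @funS _ _ _ _ f' x Dx => /= ?; rewrite ltn_add2l.
move=> x y; rewrite !inE => ADx ADy; case: pselect => [Ax|nAx]; case: pselect => [Ay|nAy].
- by apply: inj; rewrite inE.
- by have := @funS _ _ _ _ f x Ax => /= h e; move: h; rewrite e; lia.
- by have := @funS _ _ _ _ f y Ay => /= h e; move: h; rewrite -e; lia.
- move=> /addnI; apply: inj; rewrite inE; [by case: ADx|by case: ADy].
Qed.

Lemma small_subn A A' a b : smalln A a -> A' `<=` A -> le_nat a b -> smalln A' b.
Proof.
move=> /smallnP Aa A'A ab; apply/smallnP.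
apply: card_le_trans (subset_card_le A'A) (card_le_trans Aa _).
by rewrite card_le_II.
Qed.

Lemma big_subn A A' a b : bign A a -> A `<=` A' -> le_nat b a -> bign A' b.
Proof.
move=> /bignP Aa A'A ab; apply/bignP.
by apply: card_le_trans (card_le_trans _ Aa) (subset_card_le A'A); rewrite card_le_II.
Qed.

Lemma card_setD_II Z A a b :
  (`I_(a + b) #<= Z)%card -> (A #<= `I_a)%card -> (`I_b #<= Z `\` A)%card.
Proof.
move=> abZ Aa.
case: b abZ => [|b] abZ; first by rewrite II0 card_ge0.
have [//|] := card_le_or_II (Z `\` A) b => /smallnP ZA.
have /smallnP h := smallnU ZA ((smallnP _ _).2 Aa).
have : (`I_(a + b.+1) #<= `I_(b + a))%card.
  apply: card_le_trans abZ (card_le_trans _ h); apply: subset_card_le => x Zx.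
  by have [Ax|nAx] := pselect (A x); [right|left].
by rewrite card_le_II; lia.
Qed.

Lemma card_setU_II A D a b : (`I_a #<= A)%card -> (`I_b #<= D)%card ->
  A `&` D = set0 -> (`I_(a + b) #<= A `|` D)%card.
Proof.
move=> /pcard_leP [f] /pcard_leP [f'] AD.
apply: (@injr_card _ [set p | `I_(a + b) p.1 /\
  (fun x => if (x < a)%N then f x else f' (x - a)) p.1 = p.2]).
have fA x : (x < a)%N -> A (f x) by move=> xa; apply: (@funS _ _ _ _ f).
have fD x : ~ (x < a)%N -> (x < a + b)%N -> D (f' (x - a)).
  by move=> xa xb; apply: (@funS _ _ _ _ f') => /=; lia.
apply: (injr_fun (f := fun x => if (x < a)%N then f x else f' (x - a))) => [x /= xab|x y].
  by case: ifPn => [xa|/negP xa]; [left; exact: fA|right; exact: fD].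
rewrite !inE /= => xab yab; case: ifPn => [xa|/negP xa]; case: ifPn => [ya|/negP ya].
- by apply: inj; rewrite inE.
- move=> e; have : (A `&` D) (f x) by split; [exact: fA|rewrite e; exact: fD].
  by rewrite AD.
- move=> e; have : (A `&` D) (f y) by split; [exact: fA|rewrite -e; exact: fD].
  by rewrite AD.
- move=> e; suff : x - a = y - a by lia.
  by apply: (inj (f := f') _ _ e); rewrite inE /=; lia.
Qed.

Definition dom T (g : set (T * T)) : set T := [set x | exists y, g (x, y)].
Definition ran T (g : set (T * T)) : set T := [set y | exists x, g (x, y)].

Lemma room_outsiden g A a b : pinj g -> iic le_nat (a + b) `<=` dom g -> smalln A a ->
  exists h, injr h (iio le_nat b) [set y | ran g y /\ ~ A y].
Proof.
move=> gi gab /smallnP Aa; apply: card_injr; rewrite iio_nat.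
apply: (card_setD_II (Z := ran g)) Aa.
apply: (@injr_card _ [set p | `I_(a + b) p.1 /\ g p]); split=> [|x xab|x y [/= xab gxy]].
- case: gi => gf gi; split=> [x y y' [_ gx] [_]|x x' y [_ gx] [_]]; [exact: gf gx|exact: gi gx].
- have [|y gxy] := gab x; last by exists y.
  by rewrite iic_nat /= in xab *; exact: leqW.
- by split=> //; exists x.
Qed.

Lemma inj_bign A : exists g, injr g [set y | bign A y] A.
Proof.
apply: card_injr; have [[n An]|Ainf] := pselect (finite_set A); last first.
  by apply: card_le_trans ((infiniteP _).1 Ainf); apply: subset_card_le.
rewrite card_eq_sym in An; rewrite -(card_le_eqr An).
apply: subset_card_le => y /= /bignP; rewrite -(card_le_eqr An) card_le_II //.
Qed.

Lemma injr_extendn P' P Q g h v : smalln P' v -> P' `<=` P -> injr g P' Q ->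
  injr h P Q -> exists g', g `<=` g' /\ injr g' P Q.
Proof.
move=> /smallnP P'v P'P gi hi.
have [[gf ginj] gP' gQ] := gi.
have P'ran : (P' #<= ran g)%card.
  apply: (@injr_card _ g); split=> // x y gxy; split; first by case: (gQ x y gxy).
  by exists x.
have ranP' : (ran g #<= P')%card.
  apply: (@injr_card _ [set p | g (p.2, p.1)]); split=> //=.
    split=> [x y y' /= gyx gyx'|x x' y /= gx gx']; [exact: ginj gyx gyx'|exact: gf gx gx'].
  by move=> x y gyx; split; [exists y|case: (gQ _ _ gyx)].
have P'fin : finite_set P' by apply/finite_set_leP; exists v.
have ranfin : finite_set (ran g) by apply: card_le_finite ranP' P'fin.
have : (P `\` P' #<= Q `\` ran g)%card.
  have [[k Ek]|inf] := pselect (finite_set (P `\` P')); last first.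
    have Pinf : infinite_set P by move=> Pf; apply: inf; apply: sub_finite_set Pf => x [].
    have Qinf : infinite_set Q by move=> Qf; apply: Pinf; apply: card_le_finite (injr_card hi) Qf.
    have /infiniteP := infinite_setD Qinf ranfin.
    by apply: card_le_trans; apply: subset_card_le.
  rewrite (card_le_eql Ek).
  have [p Ep] := P'fin.
  apply: (card_setD_II (a := p)); last by apply: card_le_trans ranP' _; rewrite (card_le_eql Ep).
  apply: card_le_trans (injr_card hi).
  have -> : P = P' `|` (P `\` P') by rewrite setDUK.
  apply: card_setU_II; last by rewrite setDIK.
    by rewrite card_eq_sym in Ep; rewrite -(card_le_eqr Ep).
  by rewrite card_eq_sym in Ek; rewrite -(card_le_eqr Ek).
move=> /card_injr [k [[kf kinj] kP kQ]].
exists (g `|` k); split; first by move=> ? ?; left.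
split.
- split=> [x y y' [xy|xy] [xy'|xy']|x x' y [xy|xy] [xy'|xy']].
  + exact: gf xy xy'.
  + by have [[]] := kQ _ _ xy'; have [] := gQ _ _ xy.
  + by have [[]] := kQ _ _ xy; have [] := gQ _ _ xy'.
  + exact: kf xy xy'.
  + exact: ginj xy xy'.
  + by have [_ [_ []]] := kQ _ _ xy'; exists x.
  + by have [_ [_ []]] := kQ _ _ xy; exists x'.
  + exact: kinj xy xy'.
- move=> x Px; have [/gP' [y]|nx] := pselect (P' x); first by exists y; left.
  by have [y] := kP x (conj Px nx); exists y; right.
- move=> x y [/gQ [/P'P] //|/kQ [[? _] []]] //.
Qed.

Lemma small_shiftn A a : smalln A a -> forall s, exists g,
  injr g A [set y | le_nat s y /\ ~ le_nat (s + a) y].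
Proof.
move=> /smallnP Aa s; apply: card_injr; apply: card_le_trans Aa _.
apply: (@injr_card _ [set p | `I_a p.1 /\ (fun x => s + x) p.1 = p.2]).
apply: (injr_fun (f := fun x => s + x)) => [x /= xa|x y _ _ /addnI //].
by rewrite /le_nat; split; [exact: leq_addr|apply/negP; rewrite -ltnNge ltn_add2l].
Qed.

Lemma small_iion a : smalln (iio le_nat a) a.
Proof. by apply/smallnP; rewrite iio_nat. Qed.

Lemma least_nat A : A !=set0 -> exists a, A a /\ forall y, A y -> le_nat a y.
Proof.
case=> x Ax; have ex : exists n, `[< A n >] by exists x; apply/asboolP.
case: (ex_minnP ex) => n /asboolP An nmin; exists n; split=> // y Ay.
by apply: nmin; apply/asboolP.
Qed.

Lemma small0n a : smalln set0 a.
Proof. by apply/smallnP; apply: card_ge0. Qed.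

End StandardFacts.

(** * Internal injections *)

Section HyperArithmetic.
Variable W : nonstandard_universe.
Notation B := (hbase W).
Notation H := (hnat W).

Lemma Tr_and3 t P1 Q1 P2 Q2 P3 Q3 : @Tr W t P1 Q1 -> @Tr W t P2 Q2 -> @Tr W t P3 Q3 ->
  Tr (fun x => [/\ P1 x, P2 x & P3 x]) (fun x => [/\ Q1 x, Q2 x & Q3 x]).
Proof.
move=> h1 h2 h3; have h := Tr_and h1 (Tr_and h2 h3).
apply: MkTr => x xi; split=> [|[q1 q2 q3]].
  have -> : (fun x => [/\ P1 x, P2 x & P3 x]) = (fun x => P1 x /\ P2 x /\ P3 x).
    by apply: funext => y; apply: propext; split=> [[]|[? []]].
  by move/(TrE h xi) => [? []].
have -> : (fun x => [/\ P1 x, P2 x & P3 x]) = (fun x => P1 x /\ P2 x /\ P3 x).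
  by apply: funext => y; apply: propext; split=> [[]|[? []]].
by apply/(TrE h xi).
Qed.

Lemma Tr_all_base2 t (P : elt nat t -> nat * nat -> Prop) (Q : elt B t -> H * H -> Prop) :
  @Tr W (prd t (prd base base)) (fun p => P p.1 p.2) (fun p => Q p.1 p.2) ->
  Tr (fun x => forall y, P x y) (fun x => forall y, Q x y).
Proof.
move=> PQ; apply: MkTr => x xi; rewrite (TrE (Tr_all (u := prd base base) PQ) xi).
split=> h y *; apply: h => //; case: y => a b.
by apply/(internal_pair (t := base) (u := base)); split; exact: internal_base.
Qed.

Lemma Tr_le t f g f' g' : @Ext W t base f g -> @Ext W t base f' g' ->
  Tr (fun x => le_nat (f x) (f' x)) (fun x => hle (g x) (g' x)).
Proof.
move=> fg fg'.
have T : @Tr W (prd base base) [set p | le_nat p.1 p.2] (fun p => hle p.1 p.2).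
  by apply: MkTr => -[].
exact: (Tr_comp (Ext_pair fg fg') T).
Qed.

Lemma hopP f (x y : H) :
  star W (pow (prd (prd base base) base)) (op_graph f) (x, y, hop f x y).
Proof. by rewrite /hop; case: cid. Qed.

Lemma Ext_op t op f g f' g' : @Ext W t base f g -> @Ext W t base f' g' ->
  @Ext W t base (fun x => op (f x) (f' x)) (fun x => hop op (g x) (g' x)).
Proof.
move=> fg fg'.
have E : @Ext W (prd base base) base (fun p => op p.1 p.2) (fun p => hop op p.1 p.2).
  by apply: MkExt => -[x y] _; exact: hopP.
exact: (Ext_comp (Ext_pair fg fg') E).
Qed.

Lemma Tr_false t : @Tr W t (fun _ => False) (fun _ => False).
Proof.
have e := @Ext_id W t.
have := Tr_not (Tr_eq e e); congr Tr; apply: funext => x; apply: propext; by split=> // /(_ erefl).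
Qed.

Lemma Ext_const t n : @Ext W t base (fun _ => n) (fun _ => std W n).
Proof.
apply: MkExt => x xi.
have /= := (transfer W (G := [:: pow t; base; pow (prd t base)])
  (fall (vz _ _) (fex (vs _ (vs _ (vs _ (vz _ _))))
     (fpair (vs _ (vz _ _)) (vs _ (vs _ (vs _ (vz _ _)))) (vz _ _))))
   (setT, (n, (@graph t base (fun _ => n), tt)))).1.
move=> h; have [||q [gq <-]] := h _ x; last by [].
  by move=> a _; exists (a, n).
exact/internalE.
Qed.

Lemma transfer_prop P Q : @Tr W base (fun _ => P) (fun _ => Q) -> P -> Q.
Proof. by move=> PQ p; apply: (transfer_all PQ (fun _ => p) (internal_base (std W 0))). Qed.

Definition big (A : set H) c :=
  exists g, internal (t := pow (prd base base)) g /\ injr g (iic (@hle W) c) A.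
Definition small (A : set H) c :=
  exists g, internal (t := pow (prd base base)) g /\ injr g A (iio (@hle W) c).

End HyperArithmetic.

Ltac tr_unfold :=
  cbv beta delta [bign smalln big small injr pinj iic iio dom ran mkset subset setU setI setD
    set0 setC set1 nonempty iff].

Ltac proj_ty t f :=
  lazymatch f with
  | fun x => x => t
  | fun x => @fst _ _ (@?g x) => lazymatch proj_ty t g with prd ?u _ => u end
  | fun x => @snd _ _ (@?g x) => lazymatch proj_ty t g with prd _ ?u => u end
  end.

Ltac tr_step :=
  cbv beta;
  match goal with
  | |- @Tr ?W ?t (fun x => forall y : nat, @?P x y) (fun x => forall y, @?Q x y) =>
      refine (@Tr_all_base W t P Q _)
  | |- @Tr ?W ?t (fun x => exists y : nat, @?P x y) (fun x => exists y, @?Q x y) =>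
      refine (@Tr_ex_base W t P Q _)
  | |- @Tr ?W ?t (fun x => forall y : nat * nat, @?P x y) (fun x => forall y, @?Q x y) =>
      refine (@Tr_all_base2 W t P Q _)
  | |- @Tr ?W ?t (fun x => forall y : set nat, @?P x y) (fun x => forall y, _ -> @?Q x y) =>
      refine (@Tr_all W t (pow base) P Q _)
  | |- @Tr ?W ?t (fun x => exists y : set nat, @?P x y) (fun x => exists y, _ /\ @?Q x y) =>
      refine (@Tr_ex W t (pow base) P Q _)
  | |- @Tr ?W ?t (fun x => forall y : set (nat * nat), @?P x y) (fun x => forall y, _ -> @?Q x y) =>
      refine (@Tr_all W t (pow (prd base base)) P Q _)
  | |- @Tr ?W ?t (fun x => exists y : set (nat * nat), @?P x y) (fun x => exists y, _ /\ @?Q x y) =>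
      refine (@Tr_ex W t (pow (prd base base)) P Q _)
  | |- @Tr ?W ?t (fun _ => False) (fun _ => False) => exact (@Tr_false W t)
  | |- @Tr ?W ?t (fun x => ~ @?P x) (fun x => ~ @?Q x) => refine (@Tr_not W t P Q _)
  | |- @Tr ?W ?t (fun x => @?P x /\ @?P' x) (fun x => @?Q x /\ @?Q' x) =>
      refine (@Tr_and W t P Q P' Q' _ _)
  | |- @Tr ?W ?t (fun x => @?P x \/ @?P' x) (fun x => @?Q x \/ @?Q' x) =>
      refine (@Tr_or W t P Q P' Q' _ _)
  | |- @Tr ?W ?t (fun x => and3 (@?P x) (@?P' x) (@?P'' x)) (fun x => and3 (@?Q x) (@?Q' x) (@?Q'' x)) =>
      refine (@Tr_and3 W t P Q P' Q' P'' Q'' _ _ _)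
  | |- @Tr ?W ?t (fun x => @?P x -> @?P' x) (fun x => @?Q x -> @?Q' x) =>
      refine (@Tr_imp W t P Q P' Q' _ _)
  | |- @Tr ?W ?t (fun x => @?f x = @?f' x) (fun x => @?g x = @?g' x) =>
      first [ refine (@Tr_eq W t base f g f' g' _ _)
            | refine (@Tr_eq W t (prd base base) f g f' g' _ _) ]
  | |- @Tr ?W ?t (fun x => le_nat (@?f x) (@?f' x)) (fun x => hle (@?g x) (@?g' x)) =>
      refine (@Tr_le W t f g f' g' _ _)
  | |- @Tr ?W ?t (fun x => @snd _ _ (@?f' x) (@?f x)) (fun x => @snd _ _ (@?g' x) (@?g x)) =>
      first [ refine (@Tr_mem W t base f g (fun x => snd (f' x)) (fun x => snd (g' x)) _ _)
            | refine (@Tr_mem W t (prd base base) f g (fun x => snd (f' x)) (fun x => snd (g' x)) _ _) ]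
  | |- @Tr ?W ?t (fun x => @fst _ _ (@?f' x) (@?f x)) (fun x => @fst _ _ (@?g' x) (@?g x)) =>
      first [ refine (@Tr_mem W t base f g (fun x => fst (f' x)) (fun x => fst (g' x)) _ _)
            | refine (@Tr_mem W t (prd base base) f g (fun x => fst (f' x)) (fun x => fst (g' x)) _ _) ]
  | |- @Ext ?W ?t _ (fun x => x) _ => exact (@Ext_id W t)
  | |- @Ext ?W ?t _ (fun x => (@?f x, @?f' x)) (fun x => (@?g x, @?g' x)) =>
      refine (@Ext_pair W t base base f g f' g' _ _)
  | |- @Ext ?W ?t base (fun x => addn (@?f x) (@?f' x)) (fun x => hop addn (@?g x) (@?g' x)) =>
      refine (@Ext_op W t addn f g f' g' _ _)
  | |- @Ext ?W ?t base (fun x => muln (@?f x) (@?f' x)) (fun x => hop muln (@?g x) (@?g' x)) =>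
      refine (@Ext_op W t muln f g f' g' _ _)
  | |- @Ext ?W ?t base (fun x => divn (@?f x) (@?f' x)) (fun x => hop divn (@?g x) (@?g' x)) =>
      refine (@Ext_op W t divn f g f' g' _ _)
  | |- @Ext ?W ?t base (fun _ => ?n) (fun _ => std _ ?n) => exact (@Ext_const W t n)
  | |- @Ext ?W ?t _ (fun x => @fst _ _ (@?f x)) (fun x => @fst _ _ (@?g x)) =>
      lazymatch proj_ty t f with prd ?u ?v => refine (@Ext_fst W u v t f g _) end
  | |- @Ext ?W ?t _ (fun x => @snd _ _ (@?f x)) (fun x => @snd _ _ (@?g x)) =>
      lazymatch proj_ty t f with prd ?u ?v => refine (@Ext_snd W u v t f g _) end
  end.
Ltac tr := tr_unfold; repeat tr_step.

Ltac by_transfer W lem := refine (@transfer_prop W _ _ _ lem); tr.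
Ltac by_transfer_of W P := refine (@transfer_prop W P _ _ _); [tr|].

Section Facts.
Variable W : nonstandard_universe.
Notation H := (hnat W).
Implicit Types (A D : set H) (c a b : H).

Lemma big_or_small A : internal (t := pow base) A -> forall c, big A c \/ small A c.
Proof.
move: A; by_transfer W big_or_smalln.
Qed.

Lemma small_setU A : internal (t := pow base) A -> forall D, internal (t := pow base) D ->
  forall a b, small A a -> small D b -> small (A `|` D) (hop addn a b).
Proof. by move: A; by_transfer W smallnU. Qed.

Lemma small_subset A : internal (t := pow base) A -> forall D, internal (t := pow base) D ->
  forall a b, small A a -> D `<=` A -> hle a b -> small D b.
Proof. by move: A; by_transfer W small_subn. Qed.

Lemma big_subset A : internal (t := pow base) A -> forall D, internal (t := pow base) D ->
  forall a b, big A a -> A `<=` D -> hle b a -> big D b.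
Proof. by move: A; by_transfer W big_subn. Qed.

Lemma iic_iio a c : forall g, internal (t := pow (prd base base)) g ->
  injr g (iic (@hle W) a) (iio (@hle W) c) -> ~ hle c a.
Proof. by move: a c; by_transfer W iic_iion. Qed.

Lemma room_outside g : internal (t := pow (prd base base)) g ->
  forall A, internal (t := pow base) A -> forall a b,
  pinj g -> iic (@hle W) (hop addn a b) `<=` dom g -> small A a ->
  exists h, internal (t := pow (prd base base)) h /\
    injr h (iio (@hle W) b) [set y | ran g y /\ ~ A y].
Proof. by move: g; by_transfer W room_outsiden. Qed.

Lemma inj_big A : internal (t := pow base) A ->
  exists g, internal (t := pow (prd base base)) g /\ injr g [set y | big A y] A.
Proof. by move: A; by_transfer W inj_bign. Qed.

Lemma injr_extend P' : internal (t := pow base) P' ->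
  forall P, internal (t := pow base) P -> forall Q, internal (t := pow base) Q ->
  forall g, internal (t := pow (prd base base)) g ->
  forall h, internal (t := pow (prd base base)) h -> forall v : H,
  small P' v -> P' `<=` P -> injr g P' Q ->
  injr h P Q -> exists g', internal (t := pow (prd base base)) g' /\ (g `<=` g' /\ injr g' P Q).
Proof. by move: P'; by_transfer W injr_extendn. Qed.

Lemma small_shift A : internal (t := pow base) A -> forall a, small A a -> forall s, exists g,
  internal (t := pow (prd base base)) g /\
  injr g A [set y | hle s y /\ ~ hle (hop addn s a) y].
Proof. by move: A; by_transfer W small_shiftn. Qed.

Lemma small_iio a : small (iio (@hle W) a) a.
Proof. by move: a; by_transfer W small_iion. Qed.

Lemma small0 a : @small W set0 a.
Proof. by move: a; by_transfer W small0n. Qed.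

Lemma least_h A : internal (t := pow base) A -> (exists x, A x) ->
  exists a, A a /\ forall y, A y -> hle a y.
Proof. by move: A; by_transfer W least_nat. Qed.

Lemma hle_refl (x : H) : hle x x.
Proof. by move: x; by_transfer_of W (forall x, le_nat x x); exact: leqnn. Qed.

Lemma hle_trans (y x z : H) : hle x y -> hle y z -> hle x z.
Proof.
move: y x z; by_transfer_of W (forall y x z, le_nat x y -> le_nat y z -> le_nat x z).
by rewrite /le_nat; lia.
Qed.

Lemma hle_total (x y : H) : hle x y \/ hle y x.
Proof.
move: x y; by_transfer_of W (forall x y, le_nat x y \/ le_nat y x).
by move=> x y; apply/orP/leq_total.
Qed.

Lemma hle_anti (x y : H) : hle x y -> hle y x -> x = y.
Proof.
move: x y; by_transfer_of W (forall x y, le_nat x y -> le_nat y x -> x = y).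
by rewrite /le_nat => x y; lia.
Qed.

Lemma hle_add (x y x' y' : H) : hle x x' -> hle y y' -> hle (hop addn x y) (hop addn x' y').
Proof.
move: x y x' y'; by_transfer_of W (forall x y x' y', le_nat x x' -> le_nat y y' ->
  le_nat (x + y) (x' + y')).
by rewrite /le_nat; lia.
Qed.

Lemma hle_addl (x y : H) : hle x (hop addn x y).
Proof. by move: x y; by_transfer_of W (forall x y, le_nat x (x + y)); rewrite /le_nat; lia. Qed.

Lemma std_add m n : std W (m + n) = hop addn (std W m) (std W n).
Proof. by by_transfer_of W (m + n = m + n). Qed.

Lemma hle_stdS n x : hle x (std W n.+1) -> x = std W n.+1 \/ hle x (std W n).
Proof.
move: x; by_transfer_of W (forall x, le_nat x n.+1 -> x = n.+1 \/ le_nat x n).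
by rewrite /le_nat => x; lia.
Qed.

Lemma hle_std m n : hle (std W m) (std W n) <-> (m <= n)%N.
Proof.
split; last by refine (@transfer_prop W (le_nat m n) _ _); tr.
apply: contraPT; rewrite -ltnNge => nm.
by_transfer_of W (~ le_nat m n).
by rewrite /le_nat leqNgt nm.
Qed.

Lemma hle0 (x : H) : hle (std W 0) x.
Proof. by move: x; by_transfer_of W (forall x, le_nat 0 x). Qed.

Lemma half_h (x : H) : exists y, x = hop addn y y \/ x = hop addn (hop addn y y) (std W 1).
Proof.
move: x; by_transfer_of W (forall x, exists y, x = y + y \/ x = y + y + 1).
by move=> x; exists x./2; lia.
Qed.

End Facts.

(** * Internal sets *)

Section InternalSets.
Variable W : nonstandard_universe.
Notation H := (hnat W).
Notation int1 := (internal (W := W) (t := pow base)).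
Notation int2 := (internal (W := W) (t := pow (prd base base))).

Lemma internal_base2 (p : H * H) : internal (W := W) (t := prd base base) p.
Proof. by case: p => x y; apply/(internal_pair (t := base) (u := base)); split; exact: internal_base. Qed.

Lemma int1_ext (P : set H) : (exists S, int1 S /\ forall y, S y <-> P y) -> int1 P.
Proof. by case=> S [Si SP]; have <- : S = P by apply/seteqP; split=> y /SP. Qed.

Lemma int2_ext (P : set (H * H)) :
  (exists S, int2 S /\ forall x y, S (x, y) <-> P (x, y)) -> int2 P.
Proof. by case=> S [Si SP]; have <- : S = P by apply/seteqP; split=> -[x y] /SP. Qed.

Lemma int_iio c : int1 (iio (@hle W) c).
Proof.
apply: int1_ext; move: c.
by_transfer_of W (forall c, exists S : set nat, forall y, S y <-> iio le_nat c y).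
by move=> c; exists (iio le_nat c).
Qed.

Lemma int_iic c : int1 (iic (@hle W) c).
Proof.
apply: int1_ext; move: c.
by_transfer_of W (forall c, exists S : set nat, forall y, S y <-> iic le_nat c y).
by move=> c; exists (iic le_nat c).
Qed.

Lemma int_big A : int1 A -> int1 [set y | big A y].
Proof.
move=> Ai; apply: int1_ext; move: A Ai.
by_transfer_of W (forall A, exists S : set nat, forall y, S y <-> bign A y).
by move=> c; exists [set y | bign c y].
Qed.

Lemma int_bige A k : int1 A -> int1 [set y | big A y /\ hle k y].
Proof.
move=> Ai; apply: int1_ext; move: A Ai k.
by_transfer_of W (forall A k, exists S : set nat, forall y, S y <-> bign A y /\ le_nat k y).
by move=> A k; exists [set y | bign A y /\ le_nat k y].
Qed.

Lemma int_setU A D : int1 A -> int1 D -> int1 (A `|` D).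
Proof.
move=> Ai Di; apply: int1_ext; move: A Ai D Di.
by_transfer_of W (forall A D : set nat, exists S : set nat, forall y, S y <-> (A `|` D) y).
by move=> A D; exists (A `|` D).
Qed.

Lemma int_setI A D : int1 A -> int1 D -> int1 (A `&` D).
Proof.
move=> Ai Di; apply: int1_ext; move: A Ai D Di.
by_transfer_of W (forall A D : set nat, exists S : set nat, forall y, S y <-> (A `&` D) y).
by move=> A D; exists (A `&` D).
Qed.

Lemma int_setC A : int1 A -> int1 (~` A).
Proof.
move=> Ai; apply: int1_ext; move: A Ai.
by_transfer_of W (forall A : set nat, exists S : set nat, forall y, S y <-> ~ A y).
by move=> A; exists (~` A).
Qed.

Lemma int_set0 : int1 set0.
Proof.
apply: int1_ext.
by_transfer_of W (exists S : set nat, forall y, S y <-> set0 y).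
by exists set0.
Qed.

Lemma int_set1 c : int1 [set c].
Proof.
apply: int1_ext; move: c.
by_transfer_of W (forall c, exists S : set nat, forall y, S y <-> y = c).
by move=> A; exists [set A].
Qed.

Lemma int_dom g : int2 g -> int1 (dom g).
Proof.
move=> gi; apply: int1_ext; move: g gi.
by_transfer_of W (forall g : set (nat * nat), exists S : set nat, forall y, S y <-> dom g y).
by move=> g; exists (dom g).
Qed.

Lemma int_ran g : int2 g -> int1 (ran g).
Proof.
move=> gi; apply: int1_ext; move: g gi.
by_transfer_of W (forall g : set (nat * nat), exists S : set nat, forall y, S y <-> ran g y).
by move=> g; exists (ran g).
Qed.

Lemma int_preimage g D : int2 g -> int1 D -> int1 [set x | exists y, g (x, y) /\ D y].
Proof.
move=> gi Di; apply: int1_ext; move: g gi D Di.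
by_transfer_of W (forall (g : set (nat * nat)) (D : set nat), exists S : set nat,
  forall x, S x <-> exists y, g (x, y) /\ D y).
by move=> g D; exists [set x | exists y, g (x, y) /\ D y].
Qed.

Lemma int2_setI g h : int2 g -> int2 h -> int2 (g `&` h).
Proof.
move=> gi hi; apply: int2_ext => /=; move: g gi h hi.
by_transfer_of W (forall g h : set (nat * nat), exists S : set (nat * nat),
  forall x y, S (x, y) <-> (g (x, y) /\ h (x, y))).
by move=> A D; exists (A `&` D).
Qed.

Lemma int2_setC g : int2 g -> int2 (~` g).
Proof.
move=> gi; apply: int2_ext => /=; move: g gi.
by_transfer_of W (forall g : set (nat * nat), exists S : set (nat * nat),
  forall x y, S (x, y) <-> (~` g) (x, y)).
by move=> A; exists (~` A).
Qed.

Lemma int2_fst A : int1 A -> int2 [set p | A p.1].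
Proof.
move=> Ai; apply: int2_ext => /=; move: A Ai.
by_transfer_of W (forall A : set nat, exists S : set (nat * nat),
  forall x y, S (x, y) <-> A x).
by move=> A; exists [set p | A p.1].
Qed.

Lemma int2_set1 a b : int2 [set (a, b)].
Proof.
apply: int2_ext => /=; move: a b.
refine (@transfer_prop W (forall a b, exists S : set (nat * nat),
  forall x y, S (x, y) <-> (x, y) = (a, b)) _ _ _); first by tr.
by move=> a b; exists [set (a, b)].
Qed.

Lemma int2_comp g h : int2 g -> int2 h -> int2 [set p | exists y, g (p.1, y) /\ h (y, p.2)].
Proof.
move=> gi hi; apply: int2_ext => /=; move: g gi h hi.
by_transfer_of W (forall g h : set (nat * nat), exists S : set (nat * nat),
  forall x z, S (x, z) <-> exists y, g (x, y) /\ h (y, z)).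
by move=> g h; exists [set p | exists y, g (p.1, y) /\ h (y, p.2)].
Qed.

Lemma int2_inv g : int2 g -> int2 [set p | g (p.2, p.1)].
Proof.
move=> gi; apply: int2_ext => /=; move: g gi.
by_transfer_of W (forall g : set (nat * nat), exists S : set (nat * nat),
  forall x y, S (x, y) <-> g (y, x)).
by move=> g; exists [set p | g (p.2, p.1)].
Qed.

Lemma int2_diag : int2 [set p | p.1 = p.2].
Proof.
apply: int2_ext => /=.
by_transfer_of W (exists S : set (nat * nat), forall x y, S (x, y) <-> x = y).
by exists [set p | p.1 = p.2].
Qed.

Lemma saturated t (A : nat -> set (elt (hbase W) t)) :
  (forall n, internal (t := pow t) (A n)) ->
  (forall n, exists x, forall i, (i < n)%N -> A i x) -> exists x, forall i, A i x.
Proof.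
move=> Ai Ax; have [n|x xA] := saturation Ai; last by exists x => i; exact: xA.
by have [x xA] := Ax n; exists x.
Qed.

Definition maps_to (T : Type) (P0 P Q : set T) (g : set (T * T)) :=
  [/\ pinj g, P0 `<=` dom g & forall x y, P x -> g (x, y) -> Q y].

Lemma int3_maps P0 P Q : int1 P0 -> int1 P -> int1 Q ->
  internal (W := W) (t := pow (pow (prd base base))) [set g | int2 g /\ maps_to P0 P Q g].
Proof.
move=> P0i Pi Qi.
have E : @Ext W (prd (pow base) (prd (pow base) (pow base))) (pow (pow (prd base base)))
   (fun a => [set g | maps_to a.1 a.2.1 a.2.2 g])
   (fun a => [set g | int2 g /\ maps_to a.1 a.2.1 a.2.2 g]).
  refine (@Ext_set W (prd (pow base) (prd (pow base) (pow base))) (pow (prd base base))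
    (fun a g => maps_to a.1 a.2.1 a.2.2 g)
    (fun a g => maps_to a.1 a.2.1 a.2.2 g) _).
  by rewrite /maps_to; tr.
apply: (@Ext_internal W (prd (pow base) (prd (pow base) (pow base))) (pow (pow (prd base base)))
  _ _ (P0, (P, Q)) E).
by apply/internal_pair; split=> //; apply/(internal_pair (t := pow base) (u := pow base)).
Qed.

Lemma int3_inj c A : int1 A ->
  internal (W := W) (t := pow (pow (prd base base))) [set g | int2 g /\ injr g (iic (@hle W) c) A].
Proof.
move=> Ai.
have E : @Ext W (prd base (pow base)) (pow (pow (prd base base)))
   (fun a => [set g | injr g (iic le_nat a.1) a.2])
   (fun a => [set g | int2 g /\ injr g (iic (@hle W) a.1) a.2]).
  refine (@Ext_set W (prd base (pow base)) (pow (prd base base)) (fun a g => injr g (iic le_nat a.1) a.2)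
    (fun a g => injr g (iic (@hle W) a.1) a.2) _).
  by tr.
apply: (@Ext_internal W (prd base (pow base)) (pow (pow (prd base base))) _ _ (c, A) E).
by apply/(internal_pair (t := base) (u := pow base)); split=> //; apply: internal_base.
Qed.

Lemma int3_small Y e : int1 Y ->
  internal (W := W) (t := pow (pow base)) [set P | int1 P /\ (Y `<=` P /\ small P e)].
Proof.
move=> Yi.
have E : @Ext W (prd (pow base) base) (pow (pow base))
   (fun a => [set P | a.1 `<=` P /\ smalln P a.2])
   (fun a => [set P | int1 P /\ (a.1 `<=` P /\ small P a.2)]).
  refine (@Ext_set W (prd (pow base) base) (pow base) (fun a P => a.1 `<=` P /\ smalln P a.2)
    (fun a P => a.1 `<=` P /\ small P a.2) _).
  by tr.
apply: (@Ext_internal W (prd (pow base) base) (pow (pow base)) _ _ (Y, e) E).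
by apply/(internal_pair (t := pow base) (u := base)); split=> //; apply: internal_base.
Qed.

Definition clash (T : Type) (g : set (T * T)) (z : (T * T) * (T * T)) :=
  g z.1 /\ (g z.2 /\ ((z.1.1 = z.2.1 /\ ~ z.1.2 = z.2.2) \/ (z.1.2 = z.2.2 /\ ~ z.1.1 = z.2.1))).

Lemma int3_clash g : int2 g ->
  internal (W := W) (t := pow (prd (prd base base) (prd base base))) [set z | clash g z].
Proof.
move=> gi.
have E : @Ext W (pow (prd base base)) (pow (prd (prd base base) (prd base base)))
   (fun a => [set z | clash a z])
   (fun a => [set z | internal (t := prd (prd base base) (prd base base)) z /\ clash a z]).
  refine (@Ext_set W (pow (prd base base)) (prd (prd base base) (prd base base)) (fun a z => clash a z)
    (fun a z => clash a z) _).
  by rewrite /clash; tr.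
have := Ext_internal E gi; congr internal; apply/seteqP; split=> [[p q]|[p q]] /=; first by case.
move=> h; split=> //; apply/(internal_pair (t := prd base base) (u := prd base base)).
by split; exact: internal_base2.
Qed.

Lemma pinj_clash T (g : set (T * T)) : ~ pinj g -> exists z, clash g z.
Proof.
move=> ng; apply: contrapT => /forallNP nc; apply: ng; split.
  move=> x y y' xy xy'; apply: contrapT => e; apply: (nc ((x, y), (x, y'))).
  by split=> //; split=> //; left.
move=> x x' y xy xy'; apply: contrapT => e; apply: (nc ((x, y), (x', y))).
by split=> //; split=> //; right.
Qed.

End InternalSets.

(** * Countably determined injections *)

Section Profiles.
Variable W : nonstandard_universe.
Notation H := (hnat W).
Notation int1 := (internal (W := W) (t := pow base)).
Notation int2 := (internal (W := W) (t := pow (prd base base))).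
Implicit Types (X Y : set H).

Lemma cd_profile (Z : set (H * H)) (I : countType) (A : I -> set (H * H)) :
  (forall i, int2 (A i)) -> (forall p q, Z p -> (forall i, A i p <-> A i q) -> Z q) ->
  countably_determined (t := prd base base) Z.
Proof.
move=> Ai AZ.
have i0 : int2 set0 := int2_fst (int_set0 W).
pose A' n : set (H * H) := if unpickle n is Some i then A i else set0.
have A'i n : int2 (A' n) by rewrite /A'; case: unpickle.
pose cell s : set (H * H) := [set p | forall i, (i < size s)%N -> (A' i p <-> nth false s i)].
exists [set f | exists2 p, Z p & forall i, f i = `[< A' i p >]], cell; split.
- elim/last_ind => [|s b IH].
    suff -> : cell [::] = ~` set0 by exact: int2_setC.
    by apply/seteqP; split=> p; [move=> _ []|move=> _ i].
  suff -> : cell (rcons s b) = cell s `&` (if b then A' (size s) else ~` A' (size s)).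
    by apply: int2_setI => //; case: b => //; exact: int2_setC.
  apply/seteqP; split=> p.
    move=> h; split.
      move=> i ilt; have := h i; rewrite size_rcons nth_rcons ilt; apply.
      exact: leqW.
    have := h (size s); rewrite size_rcons nth_rcons ltnn eqxx => /(_ (ltnSn _)).
    by case: (b) => -[h1 h2]; [exact: h2|move=> /h1].
  case=> h hb i; rewrite size_rcons nth_rcons ltnS leq_eqVlt => /orP[/eqP ->|ilt].
    by rewrite ltnn eqxx; case: (b) hb.
  by rewrite ilt; exact: h.
- move=> s s' /prefixP [r ->] p h i ilt.
  have := h i; rewrite size_cat nth_cat ilt; apply.
  exact: leq_trans ilt (leq_addr _ _).
- apply/seteqP; split=> [p Zp|q [f [p Zp fE] h]].
    exists (fun i => `[< A' i p >]); first by exists p.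
    move=> m _ i; rewrite size_mkseq => im; rewrite nth_mkseq //.
    by split=> [|] /asboolP.
  apply: (AZ p) => // i.
  have := h (pickle i).+1 Logic.I (pickle i); rewrite size_mkseq => /(_ (ltnSn _)).
  rewrite nth_mkseq // fE /A' pickleK => h'; rewrite h'.
  by split => /asboolP.
Qed.

(* An equivalent form of countable determination: membership in [X] depends only on
   the sequence of truth values of [A n x]. *)
Definition profile X := exists A : nat -> set H,
  (forall n, int1 (A n)) /\ forall x y, X x -> (forall n, A n x <-> A n y) -> X y.

Lemma profile_cd X : countably_determined (t := base) X -> profile X.
Proof.
case=> F [A [Ai _ ->]]; exists (fun n => if unpickle n is Some s then A s else set0).
split=> [n|x y [f Ff h] e]; first by case: unpickle => [s|] //; exact: int_set0.
exists f => // m _; have := e (pickle (mkseq f m)); rewrite pickleK => <-.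
exact: h.
Qed.

Lemma profile_bigcup (A : nat -> set H) : (forall n, int1 (A n)) -> profile (\bigcup_n A n).
Proof. by move=> Ai; exists A; split=> // x y [n _ Anx] e; exists n => //; apply/e. Qed.

Lemma profile_bigcap (P : set nat) (A : nat -> set H) :
  (forall n, int1 (A n)) -> profile (\bigcap_(n in P) A n).
Proof. by move=> Ai; exists A; split=> // x y h e n Pn; apply/e; exact: h. Qed.

Lemma le_CD_glue X Y (g : nat -> set (H * H)) : profile X ->
  (forall n, int2 (g n)) ->
  (forall n x y y', g n (x, y) -> g n (x, y') -> y = y') ->
  (forall m n x x' y, g m (x, y) -> g n (x', y) -> x = x') ->
  (forall x, X x -> exists n y, g n (x, y)) ->
  (forall n x y, X x -> g n (x, y) -> Y y) -> le_CD (W := W) (t := base) (u := base) X Y.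
Proof.
case=> A [Ai AX] gint gfun ginj gX gY.
pose first x y := exists n, g n (x, y) /\ forall i, (i < n)%N -> ~ dom (g i) x.
have first_fun x y y' : first x y -> first x y' -> y = y'.
  move=> [n [gn nn]] [m [gm nm]]; have [nm'|mn'|e] := ltngtP n m.
  - by have [] := nm n nm'; exists y.
  - by have [] := nn m mn'; exists y'.
  - by rewrite e in gn; exact: gfun gn gm.
have /choice [f fP] : forall x, exists y, X x -> first x y.
  move=> x; have [Xx|nX] := pselect (X x); last by exists x.
  have ex : exists n, `[< dom (g n) x >].
    by have [n [y gy]] := gX x Xx; exists n; apply/asboolP; exists y.
  case: (ex_minnP ex) => n /asboolP [y gy] nmin; exists y => _; exists n; split=> // i ilt.
  by move=> /asboolP /nmin; rewrite leqNgt ilt.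
exists f; split.
- by move=> x Xx; have [n [gn _]] := fP x Xx; exact: gY gn.
- move=> x x'; rewrite !inE => /fP [n [gn _]] /fP [n' [gn' _]] e.
  by apply: (ginj n n' _ _ (f x)) => //; rewrite e.
apply: (@cd_profile _ (nat + (nat + nat))%type
  (fun i => match i with inl n => [set p | A n p.1]
    | inr (inl n) => g n | inr (inr n) => [set p | dom (g n) p.1] end)).
  case=> [n|[n|n]] //; apply: int2_fst => //; exact: int_dom.
move=> [x y] [x' y'] /= [Xx fx] e.
have Xx' : X x' by apply: AX Xx _ => n; exact: (e (inl n)).
split=> //; apply: first_fun (fP _ Xx') _.
have [n [gn nn]] := fP _ Xx; exists n; split.
  by apply/(e (inr (inl n))); rewrite -fx.
by move=> i ilt /(e (inr (inr i))); exact: nn.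
Qed.

Lemma le_CD_one X Y g : profile X -> int2 g -> pinj g -> X `<=` dom g ->
  (forall x y, X x -> g (x, y) -> Y y) -> le_CD (W := W) (t := base) (u := base) X Y.
Proof.
move=> pX gi [gf ginj] Xg gY; apply: (le_CD_glue (g := fun _ => g)) => //.
  by move=> x /Xg [y]; exists 0%N, y.
Qed.

End Profiles.

Section Hall.
Variable W : nonstandard_universe.
Notation H := (hnat W).
Notation int1 := (internal (W := W) (t := pow base)).
Notation int2 := (internal (W := W) (t := pow (prd base base))).

Lemma nested_sub (T : Type) (P : nat -> set T) :
  (forall i, P i.+1 `<=` P i) -> forall m n, (m <= n)%N -> P n `<=` P m.
Proof.
move=> PS m n /subnK <-; elim: (n - m)%N => [//|k IH].
by rewrite addSn; apply: subset_trans IH; exact: PS.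
Qed.

Lemma nested_inj_fin n (P Q : nat -> set H) :
  (forall i, int1 (P i)) -> (forall i, int1 (Q i)) ->
  (forall i, P i.+1 `<=` P i) -> (forall i, Q i.+1 `<=` Q i) ->
  (forall i, exists h, int2 h /\ injr h (P i) (Q i)) ->
  (forall i, (exists v, small (P i.+1) v) \/ P i = P i.+1) ->
  exists g, [/\ int2 g, injr g (P 0%N) (Q 0%N) &
     forall i x y, (i <= n)%N -> P i x -> g (x, y) -> Q i y].
Proof.
elim: n P Q => [|n IH] P Q Pi Qi PS QS PQ Psmall.
  have [h [hi hP]] := PQ 0%N; exists h; split=> // i x y; rewrite leqn0 => /eqP -> _.
  by case: hP => _ _ h0 /h0 [].
have [||||||g [gi gP gQ]] := IH (fun i => P i.+1) (fun i => Q i.+1) => //.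
have gP0 : injr g (P 1%N) (Q 0%N).
  by case: gP => gp gd gr; split=> // x y /gr [? /QS].
have [g' [g'i gg' g'P]] : exists g', [/\ int2 g', g `<=` g' & injr g' (P 0%N) (Q 0%N)].
  have [[v Pv]|e] := Psmall 0%N; last by exists g; rewrite e; split.
  have [h [hi hP]] := PQ 0%N.
  have [g' [g'i [gg' g'P]]] := injr_extend (Pi 1%N) (Pi 0%N) (Qi 0%N) gi hi Pv (PS 0%N) gP0 hP.
  by exists g'.
exists g'; split=> // -[|i] x y ile Px g'xy.
  by case: g'P => _ _ /(_ _ _ g'xy) [].
have P1x : P 1%N x by apply: (nested_sub PS) Px.
have [_ gd _] := gP; have [y' gxy'] := gd x P1x.
have [[gf _] _ _] := g'P.
rewrite (gf _ _ _ g'xy (gg' _ gxy')).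
exact: gQ gxy'.
Qed.

Lemma nested_inj (P Q : nat -> set H) :
  (forall i, int1 (P i)) -> (forall i, int1 (Q i)) ->
  (forall i, P i.+1 `<=` P i) -> (forall i, Q i.+1 `<=` Q i) ->
  (forall i, exists h, int2 h /\ injr h (P i) (Q i)) ->
  (forall i, (exists v, small (P i.+1) v) \/ P i = P i.+1) ->
  exists g, [/\ int2 g, pinj g, P 0%N `<=` dom g &
     forall i x y, P i x -> g (x, y) -> Q i y].
Proof.
move=> Pi Qi PS QS PQ Psmall.
have [|n|g gA] := @saturated W (pow (prd base base))
    (fun i => [set g | int2 g /\ maps_to (P 0%N) (P i) (Q i) g]).
- by move=> n; exact: int3_maps.
- have [g [gi [gp gd gr] gQ]] := nested_inj_fin n Pi Qi PS QS PQ Psmall.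
  by exists g => i ilt; split=> //; split=> // x y; apply: gQ; exact: ltnW.
exists g; split; first by case: (gA 0%N).
- by case: (gA 0%N) => _ [].
- by case: (gA 0%N) => _ [].
- by move=> i x y; case: (gA i) => _ [_ _]; apply.
Qed.

End Hall.

Section Cuts.
Variable W : nonstandard_universe.
Notation H := (hnat W).
Notation int1 := (internal (W := W) (t := pow base)).
Notation int2 := (internal (W := W) (t := pow (prd base base))).
Notation "x +' y" := (hop addn x y) (at level 50, left associativity).
Implicit Types (X Y U V C : set H).

Lemma le_CD_sum X U (Y : nat -> set H) (v : nat -> H) : additive_cut U -> U (std W 0) ->
  profile X -> (forall n, int1 (Y n)) -> (forall n, U (v n)) ->
  (forall n, small (Y n) (v n)) -> X `<=` \bigcup_n Y n ->
  le_CD (W := W) (t := base) (u := base) X U.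
Proof.
move=> [Ucut Uadd] U0 pX Yi Uv Yv XY.
pose s n : H := iteri n (fun i x => x +' v i) (std W 0).
have Us n : U (s n) by elim: n => [|n IH] //=; exact: Uadd.
have sS n : hle (s n) (s n.+1) := hle_addl _ _.
have sm m n : (m <= n)%N -> hle (s m) (s n).
  move=> /subnK <-; elim: (n - m)%N => [|k IH]; first exact: hle_refl.
  by apply: hle_trans IH _; rewrite addSn; exact: sS.
have /choice [g gP] := fun n => small_shift (Yi n) (Yv n) (s n).
have lt_absurd m n x x' y : (m < n)%N -> g m (x, y) -> ~ g n (x', y).
  move=> mn gm gn; have [_ [_ _ /(_ _ _ gm) [_ [_ []]]]] := gP m.
  have [_ [_ _ /(_ _ _ gn) [_ [h _]]]] := gP n.
  exact: hle_trans (sm _ _ mn) h.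
apply: (le_CD_glue (g := g)) => //.
- by move=> n; case: (gP n).
- by move=> n; have [_ [[gf _] _ _]] := gP n.
- move=> m n x x' y gm gn; have [mn|nm|e] := ltngtP m n.
  + by have := lt_absurd _ _ _ _ _ mn gm gn.
  + by have := lt_absurd _ _ _ _ _ nm gn gm.
  + by rewrite -e in gn; have [_ [[_ gi] _ _]] := gP m; exact: gi gm gn.
- by move=> x /XY [n _ Yx]; have [_ [_ gd _]] := gP n; have [y] := gd x Yx; exists n, y.
- move=> n x y _ gn; have [_ [_ _ /(_ _ _ gn) [_ [_ h]]]] := gP n.
  by apply: Ucut (Us n.+1) _; have [] := hle_total y (s n.+1).
Qed.

Lemma le_CD_cofinal C X (w : nat -> H) : additive_cut C ->
  C = \bigcup_n iio (@hle W) (w n) -> (forall n, C (w n)) -> C (std W 0) ->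
  (forall a, C a -> exists g, int2 g /\ injr g (iic (@hle W) a) X) ->
  le_CD (W := W) (t := base) (u := base) C X.
Proof.
move=> [Ccut Cadd] CE Cw C0 CX.
pose state := ((set H * H) * set (H * H))%type.
pose good (p : state) := [/\ int1 p.1.1, C p.1.2 & small p.1.1 p.1.2].
have /choice [F FP] : forall q : nat * state, exists p, good q.2 ->
    good p /\ [/\ int2 p.2, injr p.2 (iio (@hle W) (w q.1)) (X `\` q.2.1.1),
                  q.2.1.1 `<=` p.1.1 & ran p.2 `<=` p.1.1].
  move=> [n p]; have [[Wi Cs Ws]|ng] := pselect (good p); last by exists p.
  have [g [gi [gp gd gr]]] := CX _ (Cadd _ _ Cs (Cw n)).
  have [h [hi hP]] := room_outside gi Wi gp (b := w n) gd Ws.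
  have hran : small (ran h) (w n).
    case: hP => -[hf hinj] hd hr; exists [set p | h (p.2, p.1)]; split; first exact: int2_inv.
    split=> [|y [x hxy]|y x /= hxy]; last by split; [exists x|case: (hr _ _ hxy)].
      by split=> [y x x' /= h1 h2|y y' x /= h1 h2]; [exact: hinj h1 h2|exact: hf h1 h2].
    by exists x.
  exists ((p.1.1 `|` ran h, p.1.2 +' w n), h) => _; split; split; rewrite //=.
  - by apply: int_setU => //; exact: int_ran.
  - exact: Cadd.
  - by apply: small_setU => //; exact: int_ran.
  - case: hP => hp hd hr; split=> // x y /hr [? [[z gz] nW]]; split=> //; split=> //.
    by case: (gr _ _ gz).
pose st n := iteri n (fun i p => F (i, p)) ((set0, std W 0), set0).
have stg n : good (st n).
  elim: n => [|n IH]; first by split=> //; [exact: int_set0|exact: small0].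
  by have [] := FP (n, st n) IH.
pose g n := (st n.+1).2.
have gP n : [/\ int2 (g n), injr (g n) (iio (@hle W) (w n)) (X `\` (st n).1.1),
   (st n).1.1 `<=` (st n.+1).1.1 & ran (g n) `<=` (st n.+1).1.1].
  by have [] := FP (n, st n) (stg n).
have stm m n : (m <= n)%N -> (st m).1.1 `<=` (st n).1.1.
  move=> /subnK <-; elim: (n - m)%N => [//|k IH].
  by apply: subset_trans IH _; rewrite addSn; case: (gP (k + m)%N).
have lt_absurd m n x x' y : (m < n)%N -> g m (x, y) -> ~ g n (x', y).
  move=> mn gm gn; have [_ [_ _ /(_ _ _ gn) [_ [_ nW]]] _ _] := gP n; apply: nW.
  by have [_ _ _ r] := gP m; apply: (stm _ _ mn y (r y _)); exists x.
apply: (le_CD_glue (g := g)).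
- by rewrite CE; apply: profile_bigcup => n; exact: int_iio.
- by move=> n; case: (gP n).
- by move=> n; have [_ [[gf _] _ _]] := gP n.
- move=> m n x x' y gm gn; have [mn|nm|e] := ltngtP m n.
  + by have := lt_absurd _ _ _ _ _ mn gm gn.
  + by have := lt_absurd _ _ _ _ _ nm gn gm.
  + by rewrite -e in gn; have [_ [[_ gi] _ _] _ _] := gP m; exact: gi gm gn.
- rewrite CE => x [n _ xn]; have [_ [_ gd _] _ _] := gP n.
  by have [y] := gd x xn; exists n, y.
- by move=> n x y _ gn; have [_ [_ _ r] _ _] := gP n; case: (r _ _ gn) => _ [].
Qed.

End Cuts.

(** * Uniqueness of the cut *)

Section Arithmetic.
Variable W : nonstandard_universe.
Notation H := (hnat W).
Notation "x +' y" := (hop addn x y) (at level 50, left associativity).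
Notation "x *' n" := (hop muln x (std W n)) (at level 40, left associativity).
Notation "x /' n" := (hop divn x (std W n)) (at level 40, left associativity).

Lemma hle_add_half (d e e' c : H) :
  hle (e' +' e') e -> hle (d +' e) c -> hle (d +' e' +' e') c.
Proof.
move: d e e' c; by_transfer_of W (forall d e e' c, le_nat (e' + e') e -> le_nat (d + e) c ->
  le_nat (d + e' + e') c).
by rewrite /le_nat; lia.
Qed.

Lemma hmulnDr (c : H) m n : c *' (m + n) = c *' m +' c *' n.
Proof.
move: c; by_transfer_of W (forall c, c * (m + n) = c * m + c * n).
by move=> c; rewrite mulnDr.
Qed.

Lemma hmuln0 (c : H) : c *' 0 = std W 0.
Proof. by move: c; by_transfer_of W (forall c, c * 0 = 0); exact: muln0. Qed.

Lemma hmuln1 (c : H) : c *' 1 = c.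
Proof. by move: c; by_transfer_of W (forall c, c * 1 = c); exact: muln1. Qed.

Lemma hdivn1 (c : H) : c /' 1 = c.
Proof. by move: c; by_transfer_of W (forall c, c %/ 1 = c); exact: divn1. Qed.

Lemma hle_divRL (c x : H) n : (0 < n)%N -> hle x (c /' n) <-> hle (x *' n) c.
Proof.
move=> n0; move: c x; by_transfer_of W (forall c x, le_nat x (c %/ n) <-> le_nat (x * n) c).
by move=> c x; rewrite /le_nat leq_divRL.
Qed.

Lemma hle_div_add (c x y : H) n : (0 < n)%N ->
  hle x (c /' (n + n)) -> hle y (c /' (n + n)) -> hle (x +' y) (c /' n).
Proof.
move=> n0; move: c x y; by_transfer_of W (forall c x y, le_nat x (c %/ (n + n)) ->
  le_nat y (c %/ (n + n)) -> le_nat (x + y) (c %/ n)).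
by rewrite /le_nat => c x y; rewrite !leq_divRL; lia.
Qed.

Lemma hadd0 (c : H) : std W 0 +' c = c.
Proof. by move: c; by_transfer_of W (forall c, 0 + c = c). Qed.

Lemma std_inj : injective (std W).
Proof.
move=> m n e; apply/eqP; rewrite eqn_leq; apply/andP.
by split; apply/(hle_std W); rewrite e; exact: hle_refl.
Qed.

Lemma hle_std_ex (x : H) n : hle x (std W n) -> exists2 k, (k <= n)%N & x = std W k.
Proof.
elim: n => [|n IH].
  by move=> h; exists 0%N => //; apply: hle_anti h (hle0 _).
by move/hle_stdS => [->|/IH [k kn ->]]; [exists n.+1|exists k => //; exact: leqW].
Qed.

End Arithmetic.

Section Uniqueness.
Variable W : nonstandard_universe.
Notation H := (hnat W).
Notation int1 := (internal (W := W) (t := pow base)).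
Notation int2 := (internal (W := W) (t := pow (prd base base))).
Notation "x +' y" := (hop addn x y) (at level 50, left associativity).
Notation "x *' n" := (hop muln x (std W n)) (at level 40, left associativity).
Implicit Types (X Y U V C : set H).
Notation leCD := (le_CD (W := W) (t := base) (u := base)).

Definition union_upto (T : Type) (Y : nat -> set T) n := iteri n (fun i S => S `|` Y i) set0.

Lemma union_uptoP (T : Type) (Y : nat -> set T) n x :
  union_upto Y n x <-> exists2 i, (i < n)%N & Y i x.
Proof.
elim: n => [|n IH] /=; first by split=> // -[].
split=> [[/IH [i ilt Yx]|Yx]|[i]].
- by exists i => //; exact: leqW.
- by exists n.
- by rewrite ltnS leq_eqVlt => /orP[/eqP ->|ilt] Yx; [right|left; apply/IH; exists i].
Qed.

Lemma int_union_upto (Y : nat -> set H) n :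
  (forall i, int1 (Y i)) -> int1 (union_upto Y n).
Proof. by move=> Yi; elim: n => [|n IH] /=; [exact: int_set0|exact: int_setU]. Qed.

Lemma small_union_upto (Y : nat -> set H) (e : H) n :
  (forall i, int1 (Y i)) -> (forall i, small (Y i) e) -> small (union_upto Y n) (e *' n).
Proof.
move=> Yi Ye; elim: n => [|n IH] /=; first exact: small0.
rewrite -[n.+1]addn1 hmulnDr hmuln1; apply: small_setU => //; exact: int_union_upto.
Qed.

Definition cover_le X Y := exists f : nat -> set (H * H),
  (forall n, int2 (f n) /\ pinj (f n)) /\
  forall x, X x -> exists n y, f n (x, y) /\ Y y.

Lemma cover_le_CD X Y : leCD X Y -> cover_le X Y.
Proof.
case=> f [fXY finj [F [A [Ai Aanti AE]]]].
exists (fun n => if unpickle n is Some s then if `[< pinj (A s) >] then A s else set0 else set0).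
split=> [n|x Xx].
  have P0 : int2 set0 /\ pinj (@set0 (H * H)).
    by split; [exact: int2_fst (int_set0 W)|split=> [x y y' []|x x' y []]].
  by case: unpickle => // s; case: asboolP.
have : [set p | X p.1 /\ f p.1 = p.2] (x, f x) by [].
rewrite AE => -[a Fa Aa].
have [m Pm] : exists m, pinj (A (mkseq a m)).
  apply: contrapT => /forallNP np.
  have anti m n : (m <= n)%N -> A (mkseq a n) `<=` A (mkseq a m).
    apply: (@nested_sub _ (fun m => A (mkseq a m))) => i; apply: Aanti.
    by rewrite /mkseq -[i.+1]addn1 iotaD map_cat prefix_prefix.
  have [||z zA] := @saturated W (prd (prd base base) (prd base base))
      (fun m => [set z | clash (A (mkseq a m)) z]).
  - by move=> n; exact: int3_clash.
  - move=> n; have [z [z1 [z2 zc]]] := pinj_clash (np n); exists z => i ilt.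
    by split; [apply: anti z1; exact: ltnW|split=> //; apply: anti z2; exact: ltnW].
  have in1 : (\bigcup_(f in F) \bigcap_m A (mkseq f m)) z.1.
    by exists a => // m _; case: (zA m).
  have in2 : (\bigcup_(f in F) \bigcap_m A (mkseq f m)) z.2.
    by exists a => // m _; case: (zA m) => _ [].
  move: in1 in2; rewrite -AE /= => -[Xz1 e1] [Xz2 e2].
  case: (zA 0%N) => _ [_ [[e]|[e]]]; apply; first by rewrite -e1 -e2 e.
  by apply: finj; rewrite ?inE // e1 e2.
exists (pickle (mkseq a m)), (f x); rewrite pickleK asboolT //; split; last exact: fXY.
exact: Aa.
Qed.

Lemma cover_le_trans X Y Z : cover_le X Y -> cover_le Y Z -> cover_le X Z.
Proof.
move=> [f [fi fXY]] [g [gi gYZ]].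
exists (fun n => if unpickle n is Some (i, j)
  then [set p | exists y, f i (p.1, y) /\ g j (y, p.2)] else set0); split=> [n|x Xx].
  case: unpickle => [[i j]|]; last first.
    by split; [exact: int2_fst (int_set0 W)|split=> [x y y' []|x x' y []]].
  have [fii [ff finj]] := fi i; have [gii [gf ginj]] := gi j.
  split; first exact: int2_comp.
  split=> [x z z' /= [y [f1 g1]] [y' [f2 g2]]|x x' z /= [y [f1 g1]] [y' [f2 g2]]].
    by rewrite (ff _ _ _ f1 f2) in g1; exact: gf g1 g2.
  by rewrite (ginj _ _ _ g1 g2) in f1; exact: finj f1 f2.
have [i [y [fxy Yy]]] := fXY x Xx; have [j [z [gyz Zz]]] := gYZ y Yy.
by exists (pickle (i, j)), z; rewrite pickleK; split=> //; exists y.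
Qed.

Lemma cut0 U x : cut U -> U x -> U (std W 0).
Proof. by move=> Uc Ux; apply: Uc Ux (hle0 x). Qed.

(* The sets of points sent below [e j.+1] by the [j]-th partial injection, where
   [e] halves at each step outside [U], have total size less than [c]. *)
Lemma cut_not_cover U c : additive_cut U -> U (std W 1) -> ~ U c ->
  ~ cover_le (iic (@hle W) c) U.
Proof.
move=> [Ucut Uadd] U1 Uc [f [fi fU]].
have /choice [h hP] : forall e, exists e', ~ U e -> ~ U e' /\ hle (e' +' e') e.
  move=> e; have [e' ee'] := half_h e; exists e' => Ue; split.
    by move=> Ue'; apply: Ue; case: ee' => ->; do ?apply: (Uadd).
  by case: ee' => ->; [exact: hle_refl|exact: hle_addl].
pose e n := iter n h c.
have eU n : ~ U (e n) by elim: n => // n IH; case: (hP _ IH).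
have eS n : hle (e n.+1 +' e n.+1) (e n) by case: (hP _ (eU n)).
pose E j : set H := [set x | exists y, f j (x, y) /\ iio (@hle W) (e j.+1) y].
have Ei j : int1 (E j) by apply: int_preimage; [case: (fi j)|exact: int_iio].
have Esmall j : small (E j) (e j.+1).
  have [fii [ff finj]] := fi j.
  exists (f j `&` [set p | E j p.1]); split; first by apply: int2_setI => //; exact: int2_fst.
  split.
  - by split=> [x y y' [h1 _] [h2 _]|x x' y [h1 _] [h2 _]]; [exact: ff h1 h2|exact: finj h1 h2].
  - by move=> x Ex; have [y [fxy _]] := Ex; exists y.
  - move=> x y [fxy Ex]; split=> //; have [y' [fxy' y'e]] := Ex.
    by rewrite (ff _ _ _ fxy fxy').
have [n nE] : exists n, iic (@hle W) c `<=` union_upto E n.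
  apply: contrapT => /forallNP nn.
  have [||x xA] := @saturated W base (fun i => iic (@hle W) c `&` ~` E i).
  - by move=> i; apply: int_setI; [exact: int_iic|exact: int_setC].
  - move=> n; apply: contrapT => /forallNP nx; apply: (nn n) => x xc.
    apply/union_uptoP; apply: contrapT => nex; apply: (nx x) => i ilt; split=> // Ex.
    by apply: nex; exists i.
  have [j [y [fxy Uy]]] := fU x (xA 0%N).1.
  apply: (xA j).2; exists y; split=> // ey; apply: (eU j.+1); exact: Ucut Uy ey.
have [d [dc dsmall]] : exists d, hle (d +' e n) c /\ small (union_upto E n) d.
  elim: (n) => [|k [d [dc dsmall]]].
    by exists (std W 0); rewrite hadd0; split; [exact: hle_refl|exact: small0].
  exists (d +' e k.+1); split; first exact: hle_add_half (eS k) dc.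
  by apply: small_setU => //; exact: int_union_upto.
have [g [gi gd]] := small_subset (int_union_upto n Ei) (int_iic c) dsmall nE (hle_refl d).
apply: (iic_iio gi gd); exact: hle_trans (hle_addl _ _) dc.
Qed.

Lemma le_CD_infinite X U : infinite_set X -> leCD X U -> infinite_set U.
Proof.
move=> Xinf [f [fXU finj _]] Ufin; apply: Xinf.
have := inj_card_eq finj; rewrite card_eq_sym => e.
apply: (card_le_finite (B := U)) Ufin; rewrite (card_le_eql e).
by apply: subset_card_le => _ [x Xx <-]; exact: fXU.
Qed.

Lemma infinite_cut1 U : cut U -> infinite_set U -> U (std W 1).
Proof.
move=> Uc Uinf; apply: contrapT => U1; apply: Uinf.
apply: (sub_finite_set (B := [set std W 0])); last exact: finite_set1.
move=> x Ux /=; have [h|h] := hle_total (std W 1) x; first by case: U1; exact: Uc Ux h.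
have [[|[|k]] // kle e] := hle_std_ex h.
by case: U1; rewrite -e.
Qed.

Lemma unique_cut X U V : infinite_set X -> additive_cut U -> additive_cut V ->
  equiv_CD (W := W) (t := base) (u := base) X U ->
  equiv_CD (W := W) (t := base) (u := base) X V -> U = V.
Proof.
move=> Xinf.
suff sub A D : additive_cut A -> additive_cut D ->
    equiv_CD (W := W) (t := base) (u := base) X A ->
    equiv_CD (W := W) (t := base) (u := base) X D -> D `<=` A.
  by move=> Ua Va XU XV; apply/seteqP; split; apply: sub.
move=> Aa [Dc _] [XA _] [_ DX] c Dx; apply: contrapT => Ac.
have A1 := infinite_cut1 Aa.1 (le_CD_infinite Xinf XA).
apply: (cut_not_cover Aa A1 Ac).
have [f [fi fA]] := cover_le_trans (cover_le_CD DX) (cover_le_CD XA).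
by exists f; split=> // x xc; apply: fA; exact: Dc Dx xc.
Qed.

End Uniqueness.

Section Borel.
Variable W : nonstandard_universe.
Notation H := (hnat W).
Notation int1 := (internal (W := W) (t := pow base)).

Lemma borel_internal A : int1 A -> borel (W := W) (t := base) A.
Proof. exact: sub_sigma_algebra. Qed.

Lemma borel_bigcup (A : nat -> set H) :
  (forall n, int1 (A n)) -> borel (W := W) (t := base) (\bigcup_n A n).
Proof. by move=> Ai; apply: sigma_algebra_bigcup => n; exact: borel_internal. Qed.

Lemma borel_bigcap (P : set nat) (A : nat -> set H) :
  (forall n, int1 (A n)) -> borel (W := W) (t := base) (\bigcap_(n in P) A n).
Proof.
move=> Ai; rewrite /borel -[\bigcap_(n in P) A n]setCK setC_bigcap bigcup_mkcond -setTD.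
apply: sigma_algebraCD.
by apply: borel_bigcup => n; case: ifP => _; [exact: int_setC|exact: int_set0].
Qed.

End Borel.

Section Monads.
Variable W : nonstandard_universe.
Notation H := (hnat W).
Implicit Types (X : set H).
Notation leCD := (le_CD (W := W) (t := base) (u := base)).

Lemma additive_cN c : additive_cut (cN (W := W) c).
Proof.
split=> [x y [n _ xn] yx|x y [m _ xm] [n _ yn]].
  by exists n => //; exact: hle_trans yx xn.
by exists (m + n)%N => //; rewrite /hinterval /= hmulnDr; exact: hle_add.
Qed.

Lemma additive_c_over_N c : additive_cut (c_over_N (W := W) c).
Proof.
split=> [x y xc yx n n1|x y xc yc n /= n1].
  exact: hle_trans yx (xc n n1).
apply: hle_div_add => //; [apply: xc|apply: yc] => /=; lia.
Qed.

Lemma borel_cN c : borel (W := W) (t := base) (cN (W := W) c).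
Proof. by apply: borel_bigcup => n; exact: int_iic. Qed.

Lemma borel_c_over_N c : borel (W := W) (t := base) (c_over_N (W := W) c).
Proof. by apply: borel_bigcap => n; exact: int_iic. Qed.

Definition cut_or_between X :=
  (exists! U : set H, [/\ additive_cut U, borel (W := W) (t := base) U &
     equiv_CD (W := W) (t := base) (u := base) X U])
  \/
  (exists c : H, ~ range (@std W) c /\
     lt_CD (W := W) (t := base) (u := base) (c_over_N c) X /\
     lt_CD (W := W) (t := base) (u := base) X (cN c)).

Lemma equiv_cut X U : infinite_set X -> additive_cut U -> borel (W := W) (t := base) U ->
  leCD X U -> leCD U X -> cut_or_between X.
Proof.
move=> Xinf Ua Ub XU UX; left; exists U; split=> [|V [Va _ XV]]; first by split.
exact: (unique_cut Xinf Ua Va).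
Qed.

Lemma between_monads X c : infinite_set X -> ~ range (std W) c ->
  leCD (c_over_N c) X -> leCD X (cN c) -> cut_or_between X.
Proof.
move=> Xinf cinf cX Xc.
have [h|h] := pselect (leCD X (c_over_N c)).
  exact: equiv_cut (additive_c_over_N c) (borel_c_over_N c) h cX.
have [h'|h'] := pselect (leCD (cN c) X).
  exact: equiv_cut (additive_cN c) (borel_cN c) Xc h'.
by right; exists c.
Qed.

End Monads.

(** * Existence of the cut *)

Section Countable.
Variable W : nonstandard_universe.
Notation H := (hnat W).
Implicit Types (X : set H).
Notation leCD := (le_CD (W := W) (t := base) (u := base)).

Lemma le_CD_seq (x y : nat -> H) : injective x -> injective y ->
  leCD (range x) (range y).
Proof.
move=> xi yi; have pX : profile (range x).
  have -> : range x = \bigcup_n [set x n].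
    by apply/seteqP; split=> [_ [n _ <-]|_ [n _ ->]]; exists n.
  by apply: profile_bigcup => n; exact: int_set1.
apply: (le_CD_glue (g := fun n => [set (x n, y n)])) => //.
- by move=> n; exact: int2_set1.
- by move=> n a b b' [-> ->] [].
- by move=> m n a a' b [-> ->] [-> /yi ->].
- by move=> _ [n _ <-]; exists n, (y n).
- by move=> n a b _ [_ ->]; exists n.
Qed.

Lemma countable_case X : infinite_set X -> countable X -> cut_or_between X.
Proof.
move=> Xinf Xc.
have e : ([set: nat] #= X)%card by rewrite card_eq_sym; exact: eq_card_nat.
pose Hp : pointedType := HB.pack H (gen_eqMixin H) (gen_choiceMixin H) (isPointed.Build H (std W 0)).
have [x [xX xi xs]] := @card_set_bijP nat Hp _ _ e.
have XE : X = range x by apply/seteqP; split=> [y /xs|_ [n _ <-]] //; exact: xX.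
have xinj : injective x by move=> m n; apply: xi; rewrite inE.
apply: (equiv_cut Xinf (U := range (std W))).
- split=> [y _ [n _ <-] /hle_std_ex [k _ ->]|_ _ [m _ <-] [n _ <-]]; first by exists k.
  by exists (m + n)%N => //; exact: std_add.
- have -> : range (std W) = \bigcup_n [set std W n].
    by apply/seteqP; split=> [_ [n _ <-]|_ [n _ ->]]; exists n.
  by apply: borel_bigcup => n; exact: int_set1.
- by rewrite XE; apply: le_CD_seq => //; exact: std_inj.
- by rewrite XE; apply: le_CD_seq => //; exact: std_inj.
Qed.

End Countable.

Section Main.
Variable W : nonstandard_universe.
Notation H := (hnat W).
Notation int1 := (internal (W := W) (t := pow base)).
Notation int2 := (internal (W := W) (t := pow (prd base base))).
Notation "x +' y" := (hop addn x y) (at level 50, left associativity).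
Notation "x *' n" := (hop muln x (std W n)) (at level 40, left associativity).
Notation leCD := (le_CD (W := W) (t := base) (u := base)).
Variables (F : set (nat -> bool)) (A : seq bool -> set H).
Hypothesis Ai : forall s, int1 (A s).
Hypothesis Aanti : forall s s', prefix s s' -> A s' `<=` A s.

Let X := \bigcup_(f in F) \bigcap_m A (mkseq f m).
Let B f m := A (mkseq f m).
Let C : set H := [set c | exists2 f, F f & forall m, big (B f m) c].

Let BS f m : B f m.+1 `<=` B f m.
Proof. by apply: Aanti; rewrite /mkseq -[m.+1]addn1 iotaD map_cat prefix_prefix. Qed.

Let BX f : F f -> \bigcap_m B f m `<=` X.
Proof. by move=> Ff x Bx; exists f. Qed.

Let Bi f m : int1 (B f m). Proof. exact: Ai. Qed.

Hypothesis Xinf : infinite_set X.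

Let pX : profile X.
Proof. by apply: profile_cd; exists F, A. Qed.

Lemma index_cover (Q : set H -> Prop) : Q set0 ->
  (forall f, F f -> exists m, Q (B f m)) ->
  exists Y : nat -> set H, [/\ forall n, int1 (Y n), forall n, Q (Y n) & X `<=` \bigcup_n Y n].
Proof.
move=> Q0 FQ.
exists (fun n => if unpickle n is Some s then if `[< Q (A s) >] then A s else set0 else set0).
split=> [n|n|x [f Ff Bx]].
- by case: unpickle => [s|]; [case: asboolP => // _|]; exact: int_set0.
- by case: unpickle => // s; case: asboolP.
have [m Qm] := FQ f Ff; exists (pickle (mkseq f m)) => //.
by rewrite pickleK asboolT //; exact: Bx.
Qed.

Lemma not_big A' c : int1 A' -> ~ big A' c -> small A' c.
Proof. by move=> A'i nb; case: (big_or_small A'i c). Qed.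

Lemma big_le A' a b : int1 A' -> big A' a -> hle b a -> big A' b.
Proof. by move=> Ai0 Aa ba; exact: (big_subset Ai0 Ai0 Aa (fun x h => h) ba). Qed.

Lemma cutC : cut C.
Proof. by move=> x y [f Ff h] xy; exists f => // m; exact: big_le (h m) xy. Qed.

Lemma inj_into_X c : C c -> exists g, int2 g /\ injr g (iic (@hle W) c) X.
Proof.
move=> [f Ff fc].
have [||g gA] := @saturated W (pow (prd base base))
    (fun m => [set g | int2 g /\ injr g (iic (@hle W) c) (B f m)]).
- by move=> m; exact: int3_inj.
- move=> n; have [g [gi [gp gd gr]]] := fc n; exists g => i ilt; split=> //.
  split=> // x y /gr [xc By]; split=> //; exact: (nested_sub (@BS f) (ltnW ilt)).
have [gi [gp gd _]] := gA 0%N; exists g; split=> //; split=> // x y gxy.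
split; first by have [_ [_ _ /(_ _ _ gxy) []]] := gA 0%N.
by apply: (BX Ff) => m _; have [_ [_ _ /(_ _ _ gxy) []]] := gA m.
Qed.

Lemma finite_small A' n : small A' (std W n) -> finite_set A'.
Proof.
move=> [g [_ /injr_card h]]; apply: card_le_finite h _.
apply: (sub_finite_set (B := std W @` `I_n.+1)); last exact: finite_image.
move=> x /= nx; have [|h] := hle_total (std W n) x; first by [].
by have [k kn ->] := hle_std_ex h; exists k.
Qed.

Lemma unbounded_cut : ~ countable X -> exists2 c, C c & ~ range (std W) c.
Proof.
move=> Xunc; apply: contrapT => noc; apply: Xunc.
have Cstd c : C c -> range (std W) c.
  by move=> Cc; apply: contrapT => h; apply: noc; exists c.
have [|f Ff|Y [_ Yfin XY]] := @index_cover (@finite_set H); first exact: finite_set0.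
  have [n [m h]] : exists n m, small (B f m) (std W n).
    apply: contrapT => nsmall.
    have [||c cA] := @saturated W base (fun n => [set y | big (B f n) y /\ hle (std W n) y]).
    - by move=> n; exact: int_bige.
    - move=> n; exists (std W n) => i ilt; split.
        have [//|h] := big_or_small (Bi f i) (std W n).
        by case: nsmall; exists n, i.
      by apply/hle_std; exact: ltnW.
    have [|k _ kc] := Cstd c; first by exists f => // m; case: (cA m).
    have [_] := cA k.+1; rewrite -kc => /hle_std; by rewrite ltnn.
  by exists m; exact: finite_small h.
apply: sub_countable (subset_card_le XY) _.
by apply: bigcup_countable => // n _; exact: finite_set_countable.
Qed.

Lemma le_cN c : ~ range (std W) c -> (forall f, F f -> exists m, small (B f m) (c *' 2)) ->
  leCD X (cN c).
Proof.
move=> cinf h; have [|Y [Yi Ys XY]] := @index_cover (fun Y => small Y (c *' 2)) _ h;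
  first exact: small0.
have Ca := additive_cN c.
apply: (le_CD_sum Ca _ pX Yi (v := fun _ => c *' 2) _ Ys XY).
  by exists 0%N => //; exact: hle0.
by move=> _; exists 2%N => //; exact: hle_refl.
Qed.

Lemma c_over_N_sub c : c_over_N c `<=` iic (@hle W) c.
Proof. by move=> x /(_ 1%N isT); rewrite /hinterval /= hdivn1. Qed.

Lemma non_additive_case c : ~ range (std W) c -> C c -> ~ C (c +' c) -> cut_or_between X.
Proof.
move=> cinf Cc Ccc; apply: (between_monads Xinf cinf).
  have [g [gi [gp gd gr]]] := inj_into_X Cc.
  apply: (le_CD_one _ gi gp).
  - by apply: profile_bigcap => n; exact: int_iic.
  - by move=> x /c_over_N_sub /gd.
  - by move=> x y _ /gr [].
apply: le_cN => // f Ff; apply: contrapT => nex; apply: Ccc; exists f => // m.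
apply: contrapT => nb; apply: nex; exists m.
have -> : c *' 2 = c +' c by rewrite (hmulnDr c 1 1) !hmuln1.
exact: not_big.
Qed.

Lemma C_mul y n : additive_cut C -> C y -> C (y *' n).
Proof.
move=> [_ Cadd] Cy; elim: n => [|n IH]; first by rewrite hmuln0; exact: cut0 cutC Cy.
by rewrite -addn1 hmulnDr hmuln1; exact: Cadd.
Qed.

Lemma cofinal_case : additive_cut C -> C (std W 0) ->
  (forall f, F f -> exists m v, C v /\ small (B f m) v) -> cut_or_between X.
Proof.
move=> Ca C0 h.
pose Q s v := C v /\ small (A s) v.
have /choice [v vP] : forall s, exists v, C v /\ ((exists v', Q s v') -> small (A s) v).
  move=> s; have [[v [Cv sv]]|nv] := pselect (exists v, Q s v); first by exists v.
  by exists (std W 0); split=> // ?; case: nv.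
pose w n := if unpickle n is Some s then v s else std W 0.
have Cw n : C (w n) by rewrite /w; case: unpickle => // s; case: (vP s).
have CE : C = \bigcup_n iio (@hle W) (w n).
  apply/seteqP; split=> [a [f Ff fa]|a [n _ na]].
    have [m [v' [Cv' sv']]] := h f Ff.
    have sm : small (B f m) (v (mkseq f m)) by apply: (vP _).2; exists v'.
    exists (pickle (mkseq f m)) => //; rewrite /w pickleK => va.
    have := small_subset (Bi f m) (Bi f m) sm (fun x h => h) va => -[g [gi gP]].
    have [k [ki kP]] := fa m.
    have [[gf ginj] gd gr] := gP; have [[kf kinj] kd kr] := kP.
    pose q : set (H * H) := [set p | exists y, k (p.1, y) /\ g (y, p.2)].
    apply: (iic_iio (g := q) _ _ (hle_refl a)); first exact: int2_comp.
    split.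
    - split=> [x z z' [y [h1 h2]] [y' [h3 h4]]|x x' z [y [h1 h2]] [y' [h3 h4]]] /=.
        by rewrite /= in h1 h2 h3 h4; rewrite (kf _ _ _ h1 h3) in h2; exact: gf h2 h4.
      by rewrite /= in h1 h2 h3 h4; rewrite (ginj _ _ _ h2 h4) in h1; exact: kinj h1 h3.
    - move=> x /kd [y kxy]; have [z gyz] := gd y (kr _ _ kxy).2.
      by exists z, y.
    - by move=> x z [y [/kr [? _] /gr [_ ?]]].
  by apply: cutC (Cw n) _; have [//|] := hle_total a (w n).
have Cb : borel (W := W) (t := base) C by rewrite CE; apply: borel_bigcup => n; exact: int_iio.
apply: (equiv_cut Xinf Ca Cb).
  have [|f Ff|Y [Yi YQ XY]] := @index_cover (fun Y => exists v, C v /\ small Y v).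
  - by exists (std W 0); split=> //; exact: small0.
  - exact: h.
  have /choice [u uP] := YQ.
  by apply: (le_CD_sum Ca C0 pX Yi (v := u) _ _ XY) => n; case: (uP n).
exact: (le_CD_cofinal Ca CE Cw C0 inj_into_X).
Qed.

Section Coinitial.
Variable f0 : nat -> bool.
Hypothesis Ff0 : F f0.
Hypothesis CE : C = \bigcap_m [set y | big (B f0 m) y].

Let CbE c : C c <-> forall m, big (B f0 m) c.
Proof. by rewrite CE; split=> [h m|h m _]; [exact: (h m Logic.I)|exact: h]. Qed.

Lemma le_coinitial : leCD C X.
Proof.
have [||||||g [gi gp gd gr]] := @nested_inj W (fun m => [set y | big (B f0 m) y]) (B f0).
- by move=> m; exact: int_big.
- by move=> m; exact: Bi.
- by move=> m y /= h; apply: (big_subset (Bi f0 m.+1) (Bi f0 m) h (@BS f0 m) (hle_refl y)).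
- exact: BS.
- by move=> m; exact: inj_big.
- move=> m; have [h|/existsNP [y0 ny0]] := pselect (forall y, big (B f0 m.+1) y).
    right; apply/seteqP; split=> y _; first exact: h.
    exact: (big_subset (Bi f0 m.+1) (Bi f0 m) (h y) (@BS f0 m) (hle_refl y)).
  left; exists y0.
  apply: (small_subset (int_iio y0) (int_big (Bi f0 m.+1)) (small_iio y0) _ (hle_refl y0)).
  by move=> y /= By h; apply: ny0; exact: big_le By h.
apply: (le_CD_one _ gi gp).
- by rewrite CE; apply: profile_bigcap => m; exact: int_big.
- by move=> x /CbE h; apply: gd; exact: h.
- by move=> x y /CbE h gxy; apply: (BX Ff0) => m _; apply: gr gxy; exact: h.
Qed.

Hypothesis Ca : additive_cut C.
Variable gamma : H.
Hypothesis Cgamma : C gamma.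
Hypothesis gamma_inf : ~ range (std W) gamma.

Lemma C_std n : C (std W n).
Proof.
have [h|h] := hle_total (std W n) gamma; first exact: cutC Cgamma h.
by case: gamma_inf; have [k _ ->] := hle_std_ex h; exists k.
Qed.

Lemma outside_inf e : ~ C e -> ~ range (std W) e.
Proof. by move=> Ce [n _ ne]; apply: Ce; rewrite -ne; exact: C_std. Qed.

Lemma small_outside e f : ~ C e -> F f -> exists m, small (B f m) e.
Proof.
move=> Ce Ff; apply: contrapT => nex; apply: Ce; exists f => // m.
by have [//|h] := big_or_small (Bi f m) e; case: nex; exists m.
Qed.

Lemma sub_c_over_N e : ~ C e -> C `<=` c_over_N e.
Proof.
move=> Ce y Cy n n1; apply/(hle_divRL _ _ n1).
have [//|h] := hle_total (y *' n) e.
by case: Ce; apply: cutC h; exact: C_mul.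
Qed.

Lemma monad_case e : ~ C e -> c_over_N e `<=` C -> cut_or_between X.
Proof.
move=> Ce eC; apply: (between_monads (c := e) Xinf); first exact: outside_inf.
  have -> : c_over_N e = C by apply/seteqP; split=> //; exact: sub_c_over_N.
  exact: le_coinitial.
apply: le_cN; first exact: outside_inf.
move=> f Ff; have [m h] := small_outside Ce Ff; exists m.
apply: (small_subset (Bi f m) (Bi f m) h) => //.
by rewrite (hmulnDr e 1 1) hmuln1; exact: hle_addl.
Qed.

Lemma le_monadless : (forall e, ~ C e -> exists2 e', ~ C e' & c_over_N e e') ->
  leCD X C.
Proof.
move=> Cshrink.
have [[e0 Ce0]|/forallNP Call] := pselect (exists e, ~ C e); last first.
  apply: (le_CD_one pX (int2_diag W)).
  - by split=> [x y y' /= <- <-|x x' y /= -> ->].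
  - by move=> x _; exists x.
  - by move=> x y _ _; apply: contrapT; exact: Call.
have /choice [nxt nxtP] : forall q : nat * H, exists e', ~ C q.2 ->
    [/\ ~ C e', c_over_N q.2 e' & forall y, ~ big (B f0 q.1) y -> hle e' y].
  move=> [m e]; have [Ce|nCe] := pselect (~ C e); last by exists e.
  have [Ball|/existsNP By] := pselect (forall y, big (B f0 m) y).
    have [e' Ce' e'e] := Cshrink e Ce; exists e' => _; split=> //.
  have [d [dB dmin]] := least_h (int_setC (int_big (Bi f0 m))) By.
  have Cd : ~ C d by move=> /CbE h; apply: dB; exact: h.
  have [de|ed] := hle_total d e.
    have [e' Ce' e'd] := Cshrink d Cd; exists e' => _; split=> //.
      move=> n n1; apply/(hle_divRL _ _ n1); apply: hle_trans de.
      by apply/(hle_divRL _ _ n1); exact: e'd.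
    move=> y /= /dmin; apply: hle_trans; exact: c_over_N_sub.
  have [e' Ce' e'e] := Cshrink e Ce; exists e' => _; split=> //.
  move=> y /= /dmin; apply: hle_trans; apply: hle_trans ed; exact: c_over_N_sub.
pose e n := iteri n (fun i x => nxt (i, x)) e0.
have eC n : ~ C (e n) by elim: n => // n IH; case: (nxtP (n, e n) IH).
have eP n : c_over_N (e n) (e n.+1) /\ forall y, ~ big (B f0 n) y -> hle (e n.+1) y.
  by case: (nxtP (n, e n) (eC n)).
have /choice [P PP] : forall n, exists P, [/\ int1 P, X `<=` P & small P (e n)].
  move=> n.
  have [|Y [Yi Ys XY]]  :=
    @index_cover (fun Y => small Y (e n.+1)) _ (fun f Ff => small_outside (eC n.+1) Ff).
    exact: small0.
  have [||P PA] := @saturated W (pow base) (fun k => [set P | int1 P /\ (Y k `<=` P /\ small P (e n))]).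
  - by move=> k; exact: int3_small.
  - move=> k; exists (union_upto Y k) => i ik; split; first exact: int_union_upto.
    split; first by move=> x Yx; apply/union_uptoP; exists i.
    have := small_union_upto k Yi Ys => h.
    apply: (small_subset (int_union_upto k Yi) (int_union_upto k Yi) h) => //.
    have k0 : (0 < k)%N by exact: leq_ltn_trans ik.
    by apply/(hle_divRL _ _ k0); exact: (eP n).1.
  exists P; split; first by case: (PA 0%N).
    by move=> x /XY [k _ Yx]; case: (PA k) => _ [h _]; exact: h.
  by case: (PA 0%N) => _ [].
pose P' n := iteri n (fun i S => S `&` P i.+1) (P 0%N).
have P'i n : int1 (P' n).
  by elim: n => [|n IH] /=; [case: (PP 0%N)|apply: int_setI => //; case: (PP n.+1)].
have XP' n : X `<=` P' n.
  elim: n => [|n IH] /=; first by case: (PP 0%N).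
  by move=> x Xx; split; [exact: IH|case: (PP n.+1) => _ h _; exact: h].
have P'small n : small (P' n) (e n).
  have [Pi _ Ps] := PP n; apply: (small_subset Pi (P'i n) Ps _ (hle_refl _)).
  by case: (n) => [//|k] x [].
have ele n : hle (e n.+1) (e n) by apply: c_over_N_sub; case: (eP n).
have [||||||g [gi gp gd gr]] := @nested_inj W P' (fun n => iio (@hle W) (e n)).
- exact: P'i.
- by move=> n; exact: int_iio.
- by move=> n x [].
- by move=> n x h h'; apply: h; apply: hle_trans h'; exact: ele.
- by move=> n; exact: P'small.
- by move=> n; left; exists (e n.+1); exact: P'small.
apply: (le_CD_one pX gi gp).
- by move=> x /(XP' 0%N) /gd.
- move=> x y Xx gxy; apply/CbE => m; apply: contrapT => nb.
  have := gr m.+1 x y (XP' _ _ Xx) gxy; apply; exact: (eP m).2.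
Qed.

Lemma coinitial_case : cut_or_between X.
Proof.
have [[e Ce eC]|nmonad] := pselect (exists2 e, ~ C e & c_over_N e `<=` C).
  exact: monad_case eC.
apply: (equiv_cut Xinf Ca) => //; last exact: le_coinitial.
  by rewrite CE; apply: borel_bigcap => m; exact: int_big.
apply: le_monadless => e Ce; apply: contrapT => nex; apply: nmonad; exists e => // e' ee'.
by apply: contrapT => Ce'; apply: nex; exists e'.
Qed.

End Coinitial.

Lemma cut_or_between_CD : cut_or_between X.
Proof.
have [/(countable_case Xinf) //|Xunc] := pselect (countable X).
have [gamma Cgamma gamma_inf] := unbounded_cut Xunc.
have [Ca|nCa] := pselect (additive_cut C); last first.
  have [a [b [Ca Cb Cab]]] : exists a b, [/\ C a, C b & ~ C (a +' b)].
    apply: contrapT => nex; apply: nCa; split=> [|a b Ca Cb]; first exact: cutC.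
    by apply: contrapT => Cab; apply: nex; exists a, b.
  have [c [Cc Ccc]] : exists c, C c /\ ~ C (c +' c).
    have [ab|ba] := hle_total a b; [exists b|exists a]; split=> // h; apply: Cab; apply: cutC h _;
      apply: hle_add => //; exact: hle_refl.
  apply: (non_additive_case (c := c)) => // -[n _ nc]; apply: Ccc; rewrite -nc -std_add.
  exact: C_std gamma_inf _.
have C0 : C (std W 0) := cut0 cutC Cgamma.
have [h|/existsNP [f0 /not_implyP [Ff0 nsmall]]] :=
  pselect (forall f, F f -> exists m v, C v /\ small (B f m) v).
  exact: cofinal_case.
apply: (coinitial_case Ff0 _ Ca Cgamma gamma_inf).
apply/seteqP; split=> [c Cc m _|c h]; last by exists f0 => // m; exact: h.
by have [//|sm] := big_or_small (Bi f0 m) c; case: nsmall; exists m, c.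
Qed.

End Main.

Theorem theorem4p1 (W : nonstandard_universe) (X : set (hnat W))
    (Xinf : infinite_set X) (XCD : countably_determined X) :
  (exists! U : set (hnat W), [/\ additive_cut U, borel U & equiv_CD X U])
  \/
  (exists c : hnat W, ~ range (@std W) c /\
     lt_CD (c_over_N c) X /\ lt_CD X (cN c)).
Proof.
case: XCD Xinf => F [A [Ai Aanti ->]] Xinf.
exact: (cut_or_between_CD Ai Aanti Xinf).
Qed.
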